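(* Let $\delta\in(0,1]$. Let $y$ be a fixed string of length $n$ to which the algorithm has random access, and let $x$ be an input string of length $n$ to which the algorithm has one-pass streaming access. Then: (1) There is a randomized algorithm that makes one pass through $x$, and with error probability $n^{-\Omega(1)}$ outputs an additive $\delta n$-approximation to $E(x,y)$, using space $O(k\log^2 n/\delta)$, where $k$ is the maximum number of times any single symbol appears in $y$. (2) There is a deterministic algorithm that makes one pass through $x$, uses space $O(\sqrt{(n\log n)/\delta})$, and outputs a $(1+\delta)$-multiplicative approximation to $E(x,y)$ (i.e. a value in $[E(x,y),(1+\delta)E(x,y)]$).
   Context: For strings $x,y$ of length $n$ over an alphabet $\Sigma$, $LCS(x,y)$ is the length of a longest common subsequence of $x$ and $y$, and $E(x,y)=n-LCS(x,y)$ (the edit distance when only insertions and deletions are allowed). An additive $\delta n$-approximation to $E(x,y)$ is a value $v$ with $E(x,y)\le v\le E(x,y)+\delta n$. In the asymmetric streaming model the algorithm has random access to $y$ at no cost, while the symbols of $x$ arrive one at a time in order and cannot be revisited; space is measured in memory cells holding a symbol, an index in $[n]$, or an integer of size polynomial in $n$. *)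

(* Defs.v *)
From mathcomp Require Import all_boot all_order all_algebra.
From mathcomp Require Import reals exp.
Set Implicit Arguments.
Unset Strict Implicit.
Unset Printing Implicit Defensive.
Import Order.TTheory GRing.Theory Num.Theory.

Section Strings.
Variable T : eqType.
Implicit Types x y s : seq T.

(* The subsequences of x are the [mask b x]; see [lcsP]. *)
Definition lcs x y : nat :=
  \max_(b : (size x).-tuple bool | subseq (mask b x) y) size (mask b x).

Lemma lcsP x y :
  (exists s, [/\ subseq s x, subseq s y & size s = lcs x y]) /\
  (forall s, subseq s x -> subseq s y -> size s <= lcs x y).
Proof.
split=> [|s /subseqP[b sz_b ->] sy]; last first.
  have /eqP tb := sz_b.
  exact: (@leq_bigmax_cond _ _ (fun b : _.-tuple bool => size (mask b x))
            (Tuple tb)).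
pose b0 := [tuple of nseq (size x) false].
have P0 : subseq (mask b0 x) y by rewrite mask_false sub0seq.
have [|b sby Eb] := @eq_bigmax_cond _
    [pred b : (size x).-tuple bool | subseq (mask b x) y]
    (fun b => size (mask b x)).
  by apply/card_gt0P; exists b0.
by exists (mask b x); split=> //; exact: mask_subseq.
Qed.

(* Insertions and deletions only, for strings of equal length. *)
Definition edit_dist x y : nat := size x - lcs x y.

Definition max_occ y : nat := \max_(a <- y) count_mem a y.

End Strings.

(* One elementary step of an algorithm.  The [seq nat] arguments are the new
   contents of all the integer cells.
   - [Compute m]      : internal computation;
   - [Toss f]         : draw a fresh uniform random word r, continue with [f r];
   - [ReadX d m]      : move the next symbol of the stream x to symbol cell d;
   - [QueryY i d m]   : copy the i-th symbol of y (from 0) to symbol cell d;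
   - [Test d e f]     : continue with [f b], where b tells whether the symbol
                        cells d and e have the same contents;
   - [Output v]       : stop with answer v. *)
Inductive action :=
| Compute of seq nat
| Toss of (nat -> seq nat)
| ReadX of nat & seq nat
| QueryY of nat & nat & seq nat
| Test of nat & nat & (bool -> seq nat)
| Output of nat.

(* An algorithm chooses its next action from the integer cells alone.  Symbols
   can therefore only be moved and tested for equality: over a large or infinite
   alphabet a symbol cell cannot serve to encode other information.  There is no
   state besides the cells, so working memory and control are charged too, and
   y is seen only through queries. *)
Definition algorithm := seq nat -> action.

Definition deterministic (A : algorithm) : Prop := forall m f, A m <> Toss f.

Record config (T : Type) := Config {
  ints : seq nat;
  syms : seq T;
  stream : seq T;           (* the part of x not read yet *)
  answer : option nat }.

(* Memory cells in use: neither the unread part of x nor y is charged. *)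
Definition space T (c : config T) : nat := size (ints c) + size (syms c).

Section Execution.
Variables (T : eqType) (A : algorithm) (x y : seq T).
Implicit Type c : config T.

Definition put (d : nat) (a : option T) (s : seq T) : seq T :=
  if a is Some a' then set_nth a' s d a' else s.

(* [r] is the random word of this step, ignored unless the action is a toss. *)
Definition step c (r : nat) : config T :=
  if answer c is Some _ then c else
  match A (ints c) with
  | Compute m => Config m (syms c) (stream c) None
  | Toss f => Config (f r) (syms c) (stream c) None
  | ReadX d m =>
      Config m (put d (ohead (stream c)) (syms c)) (behead (stream c)) None
  | QueryY i d m => Config m (put d (onth y i) (syms c)) (stream c) None
  | Test d e f =>
      Config (f (onth (syms c) d == onth (syms c) e)) (syms c) (stream c) None
  | Output v => Config (ints c) (syms c) (stream c) (Some v)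
  end.

(* The configuration reached after [size w] steps with random words [w]. *)
Definition run (w : seq nat) : config T :=
  foldl step (Config [::] [::] x None) w.

(* Integers and random words are smaller than q. *)
Definition runs_in_space (R : realType) (q : nat) (s : R) : Prop :=
  forall w : seq nat, all (gtn q) w ->
    all (gtn q) (ints (run w)) /\ ((space (run w))%:R <= s)%R.

Definition tape_answer q t (w : t.-tuple 'I_q) : option nat :=
  answer (run [seq val r | r <- w]).

Definition halts_within (q t : nat) : Prop :=
  forall w : t.-tuple 'I_q, tape_answer w != None.

Definition error_prob (R : realType) (q t : nat) (good : pred nat) : R :=
  (#|[set w : t.-tuple 'I_q | ~~ oapp good false (tape_answer w)]|%:R
    / #|{: t.-tuple 'I_q}|%:R)%R.

(* For deterministic algorithms, whose runs ignore the random words. *)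
Definition computes (v : nat) : Prop :=
  exists t, answer (run (nseq t 0)) = Some v.

End Execution.

Definition additive_approx (R : realType) (n : nat) (delta : R)
    (E v : nat) : bool :=
  ((E%:R : R) <= v%:R <= E%:R + delta * n%:R)%R.

Definition mult_approx (R : realType) (delta : R) (E v : nat) : bool :=
  ((E%:R : R) <= v%:R <= (1 + delta) * E%:R)%R.

(* Main.v *)
Require Import Defs.
From mathcomp Require Import all_boot all_order all_algebra.
From mathcomp Require Import reals exp.
From mathcomp Require Import sequences zify ring lra.
Set Implicit Arguments.
Unset Strict Implicit.
Unset Printing Implicit Defensive.
Import Order.TTheory GRing.Theory Num.Theory.

(* Deterministic part.  Cut x into blocks of b symbols.  For an increasing list
   e_0 < e_1 < ... of about N log n costs, where e_(i+1) is about
   (1 + 1 / N) e_i, keep the shortest prefix of y which can be aligned with the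
   part of x read so far at the cost of e_i deletions in x.  A block is processed
   exactly, and rounding the costs up loses a factor 1 + 1 / N per block, hence
   1 + delta in all if N is about 2 n / (b delta).  The space b + N log n is
   minimal for b about sqrt (n log n / delta).

   Randomized part.  Remember each symbol of x, with its matches in y, for a
   random time, such that it is still there after a steps with probability about
   min (1, K / a), where K is about log n / delta; then about K log n symbols are
   remembered at any time.  The algorithm finds the longest chain of matches each
   of which is remembered when the next one is read.  Fix an optimal alignment.
   Going back from one of its matches at time t, stop when more than
   delta matched symbols have been met for each unmatched one.  A fraction
   delta / (1 + delta) of this window is matched, so one of these symbols is still
   remembered at time t with high probability, and linking t to it skips at most
   delta matched symbols for each unmatched one.  By induction, the chain found
   misses at most delta E(x, y) matches. *)

(** * Longest common subsequences *)

Lemma onth_some T (x0 : T) s k : k < size s -> onth s k = Some (nth x0 s k).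
Proof. by move=> lt_k; rewrite onthE (nth_map x0). Qed.

Section LcsTheory.
Variable T : eqType.
Implicit Types (x y s : seq T) (a c d : T).

Lemma lcs_ub s x y : subseq s x -> subseq s y -> size s <= lcs x y.
Proof. by case: (lcsP x y) => _; apply. Qed.

Lemma lcs_le x y l :
  (forall s, subseq s x -> subseq s y -> size s <= l) -> lcs x y <= l.
Proof. by move=> le_l; have [[s [sx sy <-]] _] := lcsP x y; apply: le_l. Qed.

Lemma lcs_sizel x y : lcs x y <= size x.
Proof. by apply: lcs_le => s sx _; apply: size_subseq. Qed.

Lemma lcs_sub x x' y y' : subseq x x' -> subseq y y' -> lcs x y <= lcs x' y'.
Proof.
move=> sxx' syy'; apply: lcs_le => s sx sy.
by apply: lcs_ub; [apply: subseq_trans sxx' | apply: subseq_trans syy'].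
Qed.

Lemma lcs_nill y : lcs [::] y = 0.
Proof. by apply/eqP; rewrite -leqn0 (lcs_sizel [::]). Qed.

Lemma lcs_nilr x : lcs x [::] = 0.
Proof.
by apply/eqP; rewrite -leqn0; apply: lcs_le => s _; rewrite subseq0 => /eqP->.
Qed.

Lemma lcs_cat x1 x2 y1 y2 :
  lcs x1 y1 + lcs x2 y2 <= lcs (x1 ++ x2) (y1 ++ y2).
Proof.
have [[s1 [sx1 sy1 <-]] _] := lcsP x1 y1.
have [[s2 [sx2 sy2 <-]] _] := lcsP x2 y2.
by rewrite -size_cat lcs_ub ?cat_subseq.
Qed.

Lemma subseq_split_cat s x1 x2 : subseq s (x1 ++ x2) ->
  exists s1 s2, [/\ s = s1 ++ s2, subseq s1 x1 & subseq s2 x2].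
Proof.
case/subseqP=> m; rewrite size_cat => sz_m ->.
exists (mask (take (size x1) m) x1), (mask (drop (size x1) m) x2).
rewrite !mask_subseq -{1}(cat_take_drop (size x1) m) mask_cat //.
by rewrite size_takel // sz_m leq_addr.
Qed.

Lemma subseq_cat_split s1 s2 y : subseq (s1 ++ s2) y ->
  exists2 j, j <= size y & subseq s1 (take j y) /\ subseq s2 (drop j y).
Proof.
elim: y s1 => [|a y IHy] [|d s1] //=; try by exists 0; rewrite ?sub0seq.
case: eqP => [-> /IHy[j lejy [s1y s2y]] | ne_da /(IHy (d :: s1))[j lejy [s1y s2y]]];
  exists j.+1; rewrite //= ?eqxx //.
by case: eqP.
Qed.

Lemma lcs_split x1 x2 y : exists2 j, j <= size y &
  lcs (x1 ++ x2) y <= lcs x1 (take j y) + lcs x2 (drop j y).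
Proof.
have [[s [sx sy <-]] _] := lcsP (x1 ++ x2) y.
have [s1 [s2 [def_s s1x s2x]]] := subseq_split_cat sx.
move: sy; rewrite def_s => /subseq_cat_split[j lejy [s1y s2y]].
by exists j; rewrite ?size_cat ?leq_add ?lcs_ub.
Qed.

Lemma subseq_rcons2 s x a d : subseq (rcons s d) (rcons x a) =
  if d == a then subseq s x else subseq (rcons s d) x.
Proof.
rewrite -subseq_rev !rev_rcons /=.
by case: eqP => _; rewrite -subseq_rev ?revK ?rev_cons ?revK.
Qed.

(** Equal last letters may be matched with each other; of two different ones, a common subsequence
    leaves out at least one. This is the recurrence that [next_cell] evaluates. *)
Lemma lcs_rcons x y a c : lcs (rcons x a) (rcons y c) =
  if a == c then (lcs x y).+1 else maxn (lcs (rcons x a) y) (lcs x (rcons y c)).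
Proof.
apply/eqP; rewrite eqn_leq; apply/andP; split.
  apply: lcs_le => s; case/lastP: s => // s d.
  rewrite !subseq_rcons2 !size_rcons.
  case: (eqVneq d a) (eqVneq d c) => [->|ne_da] [eq_dc|ne_dc].
  - by rewrite ?eq_dc ?eqxx; apply: lcs_ub.
  - move=> sx sy.
    by rewrite leq_max -(size_rcons s a) lcs_ub // subseq_rcons2 eqxx.
  - move=> sx sy; rewrite -eq_dc eq_sym (negPf ne_da).
    by rewrite leq_max orbC -(size_rcons s d) lcs_ub // subseq_rcons2 eqxx.
  move=> sx sy; have le_s := lcs_ub sx sy; rewrite size_rcons in le_s.
  case: eqP => _; first by rewrite ltnW.
  by rewrite leq_max (leq_trans le_s) // lcs_sub ?subseq_rcons.
case: eqP => [<-|_].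
  by have := lcs_cat x [:: a] y [:: a]; rewrite !cats1; apply: leq_trans;
    rewrite -addn1 leq_add2l (@lcs_ub [:: a]).
by rewrite geq_max !lcs_sub ?subseq_rcons.
Qed.

Lemma take_subseq_le i j x : i <= j -> subseq (take i x) (take j x).
Proof. by move=> le_ij; rewrite -(take_takel x le_ij) take_subseq. Qed.

Lemma lcs_take_le i i' j j' x y : i <= i' -> j <= j' ->
  lcs (take i x) (take j y) <= lcs (take i' x) (take j' y).
Proof. by move=> *; rewrite lcs_sub ?take_subseq_le. Qed.

(* An optimal alignment, as the increasing lists of the positions it matches. *)
Lemma lcs_positions x y : exists I J : seq nat,
  [/\ size I = lcs x y, size J = lcs x y, sorted ltn I && sorted ltn J,
      all (gtn (size x)) I && all (gtn (size y)) J &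
      forall k, k < lcs x y -> onth x (nth 0 I k) = onth y (nth 0 J k)].
Proof.
have pos s z : subseq s z -> exists I : seq nat,
    [/\ size I = size s, sorted ltn I, all (gtn (size z)) I &
        forall k, k < size s -> onth z (nth 0 I k) = onth s k].
  case/subseqP=> m sz_m ->; exists (mask m (iota 0 (size z))).
  have sz_I : size (mask m (iota 0 (size z))) = size (mask m z).
    by rewrite !size_mask ?size_iota.
  split=> //.
  - by rewrite (subseq_sorted ltn_trans (mask_subseq _ _)) ?iota_ltn_sorted.
  - by apply/allP=> i /mem_mask; rewrite mem_iota.
  move=> k lt_k; case: z sz_m sz_I lt_k => [|x0 z] sz_m sz_I lt_k.
    by rewrite mask0 in lt_k.
  have -> : mask m (x0 :: z) =
      [seq nth x0 (x0 :: z) i | i <- mask m (iota 0 (size (x0 :: z)))].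
    by rewrite map_mask map_nth_iota0 ?take_size.
  rewrite onth_map (onth_some 0) ?sz_I //= (onth_some x0) //.
  have /mem_mask: nth 0 (mask m (iota 0 (size (x0 :: z)))) k \in
      mask m (iota 0 (size (x0 :: z))) by rewrite mem_nth ?sz_I.
  by rewrite mem_iota.
have [[s [sx sy sz_s]] _] := lcsP x y.
have [I [szI sI bI xI]] := pos _ _ sx; have [J [szJ sJ bJ yJ]] := pos _ _ sy.
exists I, J; rewrite szI szJ sI sJ bI bJ sz_s; split=> // k lt_k.
by rewrite xI ?yJ ?sz_s.
Qed.
End LcsTheory.

(** * Oblivious block machines *)

(** The integer memory is one flat list. Storing the number of lists and their lengths first makes a
    list of lists recoverable, at the price of one cell per list and one more. *)
Definition encode (u : seq (seq nat)) : seq nat :=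
  size u :: shape u ++ flatten u.

Definition decode (m : seq nat) : seq (seq nat) :=
  reshape (take (head 0 m) (behead m)) (drop (head 0 m) (behead m)).

Lemma encodeK : cancel encode decode.
Proof.
move=> u; rewrite /decode /= take_size_cat ?size_map //.
by rewrite drop_size_cat ?size_map ?flattenK.
Qed.

Lemma size_encode u : size (encode u) = (size u + sumn (shape u)).+1.
Proof. by rewrite /= size_cat size_map size_flatten. Qed.

(* An oblivious machine, which reads x in blocks of b symbols and queries y
   Z times per block.  Its first integer list is its program counter [:: m; z; a]:
   during block m, the block is read (z = 0, a < b), [start] is applied
   (z = 0, a = b), and then, for each z > 0, the symbol of y number
   (z - 1) mod n is compared with all symbols of the block (1 <= a <= b), and
   [pass] receives the outcomes.  The schedule, hence the place of the random
   words in the tape, depends neither on the data nor on the random words. *)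
Section BlockMachine.
Local Notation state := (seq (seq nat)).
Variables (n b Z nb : nat) (rnd : bool) (init : state).
Variable start : nat -> nat -> state -> state.
Variable pass : nat -> nat -> bitseq -> state -> state.
Variable out : state -> nat.

Definition next_pass m z := if z < Z then [:: m; z.+1; 0] else [:: m.+1; 0; 0].

(** Symbol cells below [b] hold the block, cell [b] the queried symbol of y. The empty memory marks
    the start, as an encoding is never empty. If x ends inside the block, the last cells hold no
    symbol of it, and the guard [m * b + a' < n] drops their outcomes. *)
Definition block_machine : algorithm := fun mem =>
  if nilp mem then Compute (encode ([:: 0; 0; 0] :: [::] :: init)) else
  if decode mem is [:: m; z; a] :: bits :: u then
    if m < nb then
      if z is z'.+1 then
        if a is a'.+1 then
          Test a' b (fun eq_ab =>
            let bits' :=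
              if m * b + a' < n then rcons bits (nat_of_bool eq_ab) else bits in
            encode (if a < b then [:: m; z; a.+1] :: bits' :: u
                    else next_pass m z :: [::]
                           :: pass m z' (map (leq 1) bits') u))
        else QueryY (z' %% n) b (encode ([:: m; z; 1] :: bits :: u))
      else if a < b then ReadX a (encode ([:: m; 0; a.+1] :: bits :: u))
      else let f r := encode (next_pass m 0 :: [::] :: start m r u) in
           if rnd then Toss f else Compute (f 0)
    else Output (out u)
  else Output 0.

Lemma block_machine_deterministic : ~~ rnd -> deterministic block_machine.
Proof.
move=> not_rnd mem f; rewrite /block_machine (negPf not_rnd).
by case: nilP => // _; case: decode => [|[|m [|z [|a [|? ?]]]] [|bits u]] //;
  case: ifP => // _; case: z => [|z]; case: a => [|a] //; case: ifP.
Qed.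

(** * Simulation of the machine by a function of the input and the random words *)

Section Semantics.
Variables (T : eqType) (x y : seq T).
Hypotheses (b_gt0 : 0 < b) (sz_x : size x = n) (sz_y : size y = n).
Hypothesis n_gt0 : 0 < n.

Definition x_block m := take b (drop (m * b) x).

Definition xy_matches m z : bitseq := [seq Some a == onth y (z %% n) | a <- x_block m].

Definition passes m k u :=
  foldl (fun u z => pass m z (xy_matches m z) u) u (iota 0 k).

Lemma passesS m k u : passes m k.+1 u = pass m k (xy_matches m k) (passes m k u).
Proof. by rewrite /passes -addn1 iotaD foldl_cat. Qed.

Fixpoint before (om : nat -> nat) m : state :=
  if m is m'.+1 then passes m' Z (start m' (om m') (before om m')) else init.

Definition during om m z : state :=
  if z is z'.+1 then passes m z' (start m (om m) (before om m))
  else before om m.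

(** Each of the [Z.+1] phases of a block takes [b.+1] steps: [b] reads and [start], or one query and
    [b] tests. The initial step, which writes [init], is not counted, whence the successor in
    [toss_time]. *)
Definition clock m z a := (m * Z.+1 + z) * b.+1 + a.

Definition toss_time m := (clock m 0 b).+1.

Variable tape : nat -> nat.
Let om m := if rnd then tape (toss_time m) else 0.

Definition bits m z a : seq nat :=
  if z is z'.+1 then [seq nat_of_bool t | t <- take a.-1 (xy_matches m z')]
  else [::].

Definition mem_at m z a := encode ([:: m; z; a] :: bits m z a :: during om m z).

Definition at_stage m z a (c : config T) : Prop :=
  [/\ ints c = mem_at m z a, stream c = drop (m * b + (if z is 0 then a else b)) x,
      answer c = None & size (syms c) <= b.+1] /\
  ((forall i, i < (if z is 0 then a else b) -> m * b + i < n ->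
      onth (syms c) i = onth x (m * b + i)) /\
   (0 < z -> 0 < a -> onth (syms c) b = onth y (z.-1 %% n))).

Lemma size_block m : size (x_block m) = minn b (n - m * b).
Proof. by rewrite size_take_min size_drop sz_x. Qed.

Lemma onth_block m i : i < b -> onth (x_block m) i = onth x (m * b + i).
Proof.
move=> lt_ib; rewrite !onthE -[in LHS]/(map Some _) map_take nth_take //.
by rewrite map_drop nth_drop.
Qed.

Lemma onth_put d c (s : seq T) i :
  onth (put d c s) i = if c is Some v then
     if i == d then c else onth (set_nth v s d v) i else onth s i.
Proof.
case: c => //= v; case: eqP => // ->.
by rewrite (onth_some v) ?nth_set_nth /= ?eqxx // size_set_nth leq_max leqnn.
Qed.

Lemma onth_put_neq d c (s : seq T) i v :
  i != d -> onth s i = Some v -> onth (put d c s) i = Some v.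
Proof.
move=> ne_id si; have lt_i : i < size s by rewrite -onthTE si.
rewrite onth_put; case: c => // v'; rewrite (negPf ne_id).
rewrite (onth_some v') ?size_set_nth ?leq_max ?lt_i ?orbT //.
by rewrite nth_set_nth /= (negPf ne_id) (onth_nth v' _ _ _ si).
Qed.

Lemma size_put d c (s : seq T) : size (put d c s) <= maxn d.+1 (size s).
Proof. by case: c => [v|]; rewrite /= ?size_set_nth ?leq_maxr. Qed.

Lemma size_bits m z a : size (bits m z a) = if z is 0 then 0 else
  minn a.-1 (size (x_block m)).
Proof. by case: z => [|z] //=; rewrite size_map size_take_min size_map. Qed.

Definition at_next m z c :=
  if z < Z then at_stage m z.+1 0 c else at_stage m.+1 0 0 c.

Local Notation step := (step block_machine y).

Lemma stepE c m z a r : at_stage m z a c ->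
  step c r =
  match block_machine (mem_at m z a) with
  | Compute m => Config m (syms c) (stream c) None
  | Toss f => Config (f r) (syms c) (stream c) None
  | ReadX d m =>
      Config m (put d (ohead (stream c)) (syms c)) (behead (stream c)) None
  | QueryY i d m => Config m (put d (onth y i) (syms c)) (stream c) None
  | Test d e f =>
      Config (f (onth (syms c) d == onth (syms c) e)) (syms c) (stream c) None
  | Output v => Config (ints c) (syms c) (stream c) (Some v)
  end.
Proof. by case=> -[<- _ noans _] _; rewrite /Defs.step noans. Qed.

Lemma block_machine_mem m z a : block_machine (mem_at m z a) =
  if m < nb then
    if z is z'.+1 then
      if a is a'.+1 then
        Test a' b (fun eq_ab =>
          let bits' := if m * b + a' < n
                       then rcons (bits m z a) (nat_of_bool eq_ab)
                       else bits m z a in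
          encode (if a < b then [:: m; z; a.+1] :: bits' :: during om m z
                  else next_pass m z :: [::]
                         :: pass m z' (map (leq 1) bits') (during om m z)))
      else QueryY (z' %% n) b (mem_at m z 1)
    else if a < b then ReadX a (mem_at m 0 a.+1)
    else let f r := encode (next_pass m 0 :: [::] :: start m r (during om m z)) in
         if rnd then Toss f else Compute (f 0)
  else Output (out (during om m z)).
Proof.
rewrite /block_machine (_ : nilp _ = false) // encodeK.
by case: ifP => // _; case: z => [|z]; case: a => [|a].
Qed.

Lemma at_next_intro m z u c : z <= Z ->
  u = passes m z (start m (om m) (before om m)) ->
  ints c = encode (next_pass m z :: [::] :: u) ->
  stream c = drop (m * b + b) x -> answer c = None -> size (syms c) <= b.+1 ->
  (forall i, i < b -> m * b + i < n -> onth (syms c) i = onth x (m * b + i)) ->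
  at_next m z c.
Proof.
move=> le_zZ def_u ints_c str_c ans_c syms_c blk_c.
rewrite /at_next; move: ints_c; rewrite /next_pass; case: ltnP => [_|le_Zz] ints_c.
  split; last by split.
  by split; rewrite // ints_c def_u /mem_at /= take0.
have def_Z : z = Z by apply/eqP; rewrite eqn_leq le_zZ.
split; last by split.
by split; rewrite // ?ints_c ?def_u ?def_Z // str_c addn0 mulSn addnC.
Qed.

Lemma step_read m a c r : m < nb -> a < b -> at_stage m 0 a c ->
  at_stage m 0 a.+1 (step c r).
Proof.
move=> lt_m lt_a at_c; rewrite (stepE _ at_c) block_machine_mem lt_m /= lt_a.
case: at_c => -[_ str_c ans_c sz_c] [blk_c _].
split; [split=> //= | split=> //= i].
- by rewrite str_c -drop1 drop_drop add1n addnS.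
- by rewrite (leq_trans (size_put _ _ _)) // geq_max ltnS (ltnW lt_a).
have hd_c : ohead (stream c) = onth x (m * b + a).
  by rewrite str_c !onthE -[in RHS](addn0 (_ + a)) -nth_drop -map_drop; case: drop.
rewrite hd_c ltnS leq_eqVlt => /orP[/eqP->|lt_ia] lt_in.
  have: onth x (m * b + a) by rewrite onthTE sz_x.
  by rewrite onth_put; case: onth => // v; rewrite eqxx.
have: onth x (m * b + i) by rewrite onthTE sz_x.
case Ei: (onth x _) => [v|] // _.
by rewrite (@onth_put_neq _ _ _ _ v) ?ltn_eqF // blk_c.
Qed.

Lemma step_start m c : m < nb -> at_stage m 0 b c ->
  at_next m 0 (step c (tape (clock m 0 b).+1)).
Proof.
move=> lt_m at_c; rewrite (stepE _ at_c) block_machine_mem lt_m /= ltnn.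
case: at_c => -[_ str_c ans_c sz_c] [blk_c _].
by case E: rnd; apply: at_next_intro => //=; rewrite /om E.
Qed.

Lemma step_query m z c r : m < nb -> z < Z -> at_stage m z.+1 0 c ->
  at_stage m z.+1 1 (step c r).
Proof.
move=> lt_m lt_z at_c; rewrite (stepE _ at_c) block_machine_mem lt_m.
case: at_c => -[_ str_c ans_c sz_c] [blk_c _].
have lt_zn : z %% n < n by rewrite ltn_mod.
split; [split=> //= | split=> [i lt_ib lt_in|_ _] /=].
- by rewrite (leq_trans (size_put _ _ _)) // geq_max leqnn.
- have: onth x (m * b + i) by rewrite onthTE sz_x.
  case Ei: (onth x _) => [v|] // _.
  by rewrite (@onth_put_neq _ _ _ _ v) ?ltn_eqF // blk_c.
have: onth y (z %% n) by rewrite onthTE sz_y.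
by rewrite onth_put; case: onth => // v; rewrite eqxx.
Qed.

Lemma bitsS m z a : a < b ->
  (if m * b + a < n then rcons (bits m z.+1 a.+1)
                           (nat_of_bool (onth x (m * b + a) == onth y (z %% n)))
   else bits m z.+1 a.+1) = bits m z.+1 a.+2.
Proof.
move=> lt_ab /=.
have sz_m : size (xy_matches m z) = minn b (n - m * b) by rewrite size_map size_block.
case: ltnP => le_n; last first.
  by rewrite !take_oversize // sz_m geq_min; apply/orP; right; lia.
have lt_a : a < size (xy_matches m z) by rewrite sz_m; lia.
rewrite -map_rcons (take_nth false) //; congr (map _ (rcons _ _)).
have: onth (xy_matches m z) a = Some (nth false (xy_matches m z) a) by rewrite (onth_some false).
rewrite onth_map onth_block //.
by case: (onth x _) => //= v [<-].
Qed.

Lemma step_test m z a c r : m < nb -> z < Z -> a < b ->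
  at_stage m z.+1 a.+1 c ->
  if a.+1 < b then at_stage m z.+1 a.+2 (step c r) else at_next m z.+1 (step c r).
Proof.
move=> lt_m lt_z lt_a at_c; rewrite (stepE _ at_c) block_machine_mem lt_m.
case: at_c => -[_ str_c ans_c sz_c] [blk_c ysym_c].
have bE : (if m * b + a < n
           then rcons (bits m z.+1 a.+1)
             (nat_of_bool (onth (syms c) a == onth (syms c) b))
           else bits m z.+1 a.+1) = bits m z.+1 a.+2.
  rewrite -bitsS // ysym_c //=.
  by case: ifP => // lt_n; rewrite blk_c.
lazy beta iota zeta; rewrite bE; case: ltnP => lt_a1; first by split.
apply: at_next_intro => //; rewrite passesS /=.
rewrite -map_comp take_oversize; last first.
  by rewrite size_map size_block; lia.
by rewrite map_id_in //= => -[].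
Qed.

Definition final_at s (c : config T) :=
  [/\ ints c = mem_at nb 0 0, answer c = Some (out (before om nb)),
      clock nb 0 0 < s & size (syms c) <= b.+1].

Definition reached s (c : config T) :=
  (exists m z a, [/\ (m < nb) || (m == nb) && (z + a == 0),
     z <= Z, a <= b, s = clock m z a & at_stage m z a c]) \/ final_at s c.

Lemma at_next_reached m z s c : m < nb -> z <= Z -> s = (clock m z b).+1 ->
  at_next m z c -> reached s c.
Proof.
rewrite /at_next => lt_m le_z ->; case: ltnP => [lt_z|le_Z] at_c; left.
  exists m, z.+1, 0; split; rewrite ?lt_m //.
  by rewrite /clock addnS mulSn; lia.
exists m.+1, 0, 0; split; rewrite //.
  by rewrite andbT orbC -leq_eqVlt.
have -> : z = Z by apply/eqP; rewrite eqn_leq le_z.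
by rewrite /clock !addn0 -addnS -mulSnr -addnS -mulSnr.
Qed.

Lemma reached_step s c : reached s c -> reached s.+1 (step c (tape s.+1)).
Proof.
case=> [[m [z [a [lt_m le_z le_a -> at_c]]]] | [mem_c ans_c lt_s sz_c]]; last first.
  by right; rewrite /Defs.step ans_c; split=> //; rewrite ltnW.
case/orP: lt_m => [lt_m | /andP[/eqP def_m]]; last first.
  rewrite addn_eq0 => /andP[/eqP def_z /eqP def_a].
  subst m z a; right; rewrite (stepE _ at_c) block_machine_mem ltnn.
  by case: at_c => -[ints_c str_c ans_c sz_c] _; split.
case: z => [|z] in le_z at_c *.
  case: (ltngtP a b) le_a => // [lt_a | def_a] _.
    left; exists m, 0, a.+1; rewrite lt_m; split=> //; first by rewrite /clock -addnS.
    exact: step_read.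
  subst a; apply: (@at_next_reached m 0) => //; exact: step_start.
case: a => [|a] in le_a at_c *.
  left; exists m, z.+1, 1; rewrite lt_m; split=> //; first by rewrite /clock -addnS.
  exact: step_query.
have := step_test (tape (clock m z.+1 a.+1).+1) lt_m le_z le_a at_c.
case: ltnP => [lt_a1 at_c' | le_ba].
  by left; exists m, z.+1, a.+2; rewrite lt_m; split=> //; rewrite /clock -addnS.
apply: at_next_reached => //; congr (clock _ _ _).+1.
by apply/eqP; rewrite eqn_leq le_a.
Qed.

Lemma reached_run s : reached s (run block_machine x y (mkseq tape s.+1)).
Proof.
elim: s => [|s IHs]; last by rewrite mkseqS /run foldl_rcons; apply: reached_step.
left; exists 0, 0, 0; split=> //; first by rewrite andbT orbC -leq_eqVlt.
by rewrite /mkseq /run /=; do 2![split=> //]; rewrite /= drop0.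
Qed.
End Semantics.

Section Correctness.
Variables (T : eqType) (x y : seq T).
Hypotheses (b_gt0 : 0 < b) (sz_x : size x = n) (sz_y : size y = n).
Hypothesis n_gt0 : 0 < n.

Definition tosses tape m := if rnd then tape (toss_time m) else 0.

(** The two steps beyond the clock are the initial one and [Output]. A run that long cannot be at a
    stage before [Output], since every such stage has clock at most [clock nb 0 0]. *)
Lemma block_machine_answer w : clock nb 0 0 + 2 <= size w ->
  answer (run block_machine x y w) =
    Some (out (before x y (tosses (nth 0 w)) nb)).
Proof.
case/lastP: w => [|w r]; first by rewrite addn2.
rewrite size_rcons addn2 ltnS => lt_w.
rewrite -{1}(mkseq_nth 0 (rcons w r)) size_rcons.
have := reached_run b_gt0 sz_x sz_y n_gt0 (nth 0 (rcons w r)) (size w).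
case=> [[m [z [a [lt_m le_z le_a def_w _]]]]|[_ -> _ _]] //.
move: lt_w; rewrite def_w ltnNge => /negP[]; rewrite /clock !addn0.
case/orP: lt_m => [lt_m | /andP[/eqP-> ]]; last first.
  by rewrite addn_eq0 => /andP[/eqP-> /eqP->]; rewrite !addn0.
apply: leq_trans (_ : (m * Z.+1 + z).+1 * b.+1 <= _).
  by rewrite mulSnr leq_add2l ltnW.
rewrite leq_mul2r; apply/orP; right.
apply: leq_trans (_ : m.+1 * Z.+1 <= _); last by rewrite leq_mul2r lt_m orbT.
by rewrite mulSnr -addnS leq_add2l.
Qed.

(** The state takes [B] cells, the outcomes of tests [b], the symbols [b.+1], and the program
    counter and the encoding a constant number. *)
Lemma block_machine_space (R : realType) q B (s : R) :
  3 < q -> Z < q -> nb < q -> b < q ->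
  (forall om m z, (forall i, om i < q) ->
     (m < nb) || (m == nb) && (z == 0) -> z <= Z ->
     let u := during x y om m z in
     [/\ (size u).+2 < q, all (gtn q) (shape u ++ flatten u)
       & size u + sumn (shape u) <= B]) ->
  ((B + 2 * b + 10)%:R <= s)%R ->
  runs_in_space block_machine x y q s.
Proof.
move=> lt3q ltZq ltnbq ltbq u_ok le_s w w_q.
case sz_w: (size w) => [|k].
  rewrite (size0nil sz_w); split=> //=.
  by apply: le_trans le_s; rewrite ler_nat.
have om_q i : tosses (nth 0 w) i < q.
  rewrite /tosses; case: rnd; last exact: leq_trans lt3q.
  case: (ltnP (toss_time i) (size w)) => [lt_i|?]; last first.
    by rewrite nth_default // (leq_trans _ lt3q).
  by move/all_nthP: w_q; apply.
have [m [z [a [le_m le_z le_a [mem_c sz_c]]]]] : exists m z a,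
   [/\ (m < nb) || (m == nb) && (z == 0), z <= Z, a <= b &
       ints (run block_machine x y w) =
       mem_at x y (nth 0 w) m z a /\ size (syms (run block_machine x y w)) <= b.+1].
  rewrite -{1 3}(mkseq_nth 0 w) sz_w.
  have := reached_run b_gt0 sz_x sz_y n_gt0 (nth 0 w) k.
  case=> [[m [z [a [le_m le_z le_a _ [[mem_c _ _ sz_c] _]]]]]|[mem_c _ _ sz_c]].
    exists m, z, a; split=> //.
    by case/orP: le_m => [->|/andP[-> ]]; rewrite // addn_eq0 => /andP[->]; rewrite orbT.
  by exists nb, 0, 0; rewrite !eqxx orbT.
have le_m' : m <= nb by case/orP: le_m => [/ltnW | /andP[/eqP->]].
have {u_ok}[sz_u all_u le_B] := u_ok _ m z om_q le_m le_z.
have le_bits : size (bits x y m z a) <= b.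
  rewrite size_bits size_block //; case: (z) => // z'.
  by rewrite geq_min orbC geq_min leqnn.
have [bits_q sz_bits] : all (gtn q) (bits x y m z a) /\ size (bits x y m z a) < q.
  split; last exact: leq_ltn_trans ltbq.
  apply/allP=> i; rewrite /bits; case: (z) => [|z'] // /mapP[t _ ->].
  by apply: leq_trans lt3q; case: t.
rewrite /Defs.space mem_c /mem_at; split; last rewrite size_encode.
  have fE (s1 s2 : seq nat) u : flatten (s1 :: s2 :: u) = s1 ++ s2 ++ flatten u by [].
  move: all_u; rewrite !all_cat => /andP[sh_u fl_u].
  have aE (i : nat) s' : all (gtn q) (i :: s') = (i < q) && all (gtn q) s' by [].
  rewrite /encode fE aE !all_cat fl_u bits_q [shape _]/= !aE sh_u.
  rewrite /= sz_u sz_bits lt3q !andbT.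
  rewrite (leq_ltn_trans le_m') // (leq_ltn_trans le_z) //.
  by rewrite (leq_ltn_trans le_a).
have sE (s1 s2 : seq nat) u : sumn (shape (s1 :: s2 :: u)) =
  size s1 + (size s2 + sumn (shape u)) by [].
apply: le_trans le_s; rewrite ler_nat sE -/(tosses (nth 0 w)).
by move: (sumn _) le_B => l le_B; rewrite /=; lia.
Qed.
End Correctness.
End BlockMachine.

(** * The deterministic algorithm *)

Section Grid.
Variable N : nat.
Hypothesis N_gt0 : 0 < N.

Fixpoint grid i := if i is i'.+1 then (grid i').+1 + grid i' %/ N else 0.

Lemma grid_addn i k : grid i + k * (grid i %/ N).+1 <= grid (i + k).
Proof.
elim: k => [|k IHk]; first by rewrite addn0 addn0.
have le_ik : grid i <= grid (i + k) by apply: leq_trans IHk; apply: leq_addr.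
by rewrite addnS /=; have := leq_div2r N le_ik; nia.
Qed.

Lemma leq_grid i : i <= grid i.
Proof. by have := grid_addn 0 i; rewrite div0n muln1. Qed.

Lemma grid_mono i j : i <= j -> grid i <= grid j.
Proof.
by move=> /subnKC <-; apply: leq_trans (grid_addn _ _); apply: leq_addr.
Qed.

(** From a value e on, [N] steps add at least N (floor(e / N) + 1) > e, so the value doubles; hence
    about N log n indices reach n. *)
Lemma grid_double h : 2 ^ h <= grid (N * h.+1).
Proof.
elim: h => [|h IHh]; first by rewrite (leq_trans _ (leq_grid _)) ?muln1.
rewrite mulnS addnC; apply: leq_trans (grid_addn _ _).
have := ltn_ceil (grid (N * h.+1)) N_gt0; rewrite expnS; nia.
Qed.

(** Take the least grid value not below [v]: its predecessor e is less than [v], and the next value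
    e + 1 + floor(e / N) is at most v + v / N. *)
Lemma grid_round P v : v <= grid P -> exists i,
  [/\ i <= P, v <= grid i & N * grid i <= N.+1 * v].
Proof.
move=> le_vP; have ex_i : exists i, v <= grid i by exists P.
case: (ex_minnP ex_i) => -[|i] le_vi min_i.
  by exists 0; rewrite muln0; split.
exists i.+1; split=> //; first exact: min_i.
have lt_iv : grid i < v by rewrite ltnNge; apply/negP => /min_i; rewrite ltnn.
have := leq_trunc_div (grid i) N; rewrite /=; nia.
Qed.

(** Integer form of (1 + 1 / N)^m (1 - m / N) <= 1, used to bound the rounding loss accumulated over
    [m] blocks. *)
Lemma bernoulli m : N.+1 ^ m * (N - m) <= N ^ m.+1.
Proof.
elim: m => [|m IHm]; first by rewrite mul1n subn0 expn1.
apply: leq_trans (_ : N * (N.+1 ^ m * (N - m)) <= _); last first.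
  by rewrite [N ^ m.+2]expnS leq_mul2l IHm orbT.
rewrite expnS mulnAC [_ ^ m * _]mulnC mulnA leq_mul2r; apply/orP; right; nia.
Qed.
End Grid.

(** * Row update in the table of longest common subsequences *)

Section LcsRow.
Variable T : eqType.
Implicit Types X Y : seq T.

Fixpoint next_cell (row : seq nat) (bits : bitseq) a :=
  if a is a'.+1 then
    if nth false bits a' then (nth 0 row a').+1
    else maxn (nth 0 row a'.+1) (next_cell row bits a')
  else 0.

Definition next_row row bits := mkseq (next_cell row bits) (size bits).+1.

Lemma next_rowE X Y c row a :
    (forall a, a <= size X -> nth 0 row a = lcs (take a X) Y) ->
  a <= size X ->
  nth 0 (next_row row [seq d == c | d <- X]) a = lcs (take a X) (rcons Y c).
Proof.
move=> rowE le_aX; rewrite nth_mkseq ?size_map ?ltnS //.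
elim: a le_aX => [|a IHa] lt_aX /=; first by rewrite take0 lcs_nill.
have [d _] : exists d : T, true by case: (X) lt_aX => // d; exists d.
rewrite (nth_map d) // (take_nth d) // lcs_rcons -(take_nth d) //.
by rewrite !rowE ?IHa // ltnW.
Qed.
End LcsRow.

(* Front p is the least length of a prefix of y which can be aligned with the
   part of x read so far at the cost of [grid N p] deletions in x, as far as the
   algorithm knows; n + 1 stands for infinity.  The state is the row of the
   dynamic program comparing the block with y from front p on, the new fronts,
   and the fronts before the block. *)
Section FrontAlgorithm.
Variables (n b N P : nat).
Local Notation state := (seq (seq nat)).
Local Notation grid := (grid N).

Definition front (J : seq nat) p := nth n.+1 J p.

Definition front_init : state := [:: [::]; [:: 0]; [::]].

Definition front_start (m r : nat) (u : state) : state :=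
  [:: [::]; [::]; nth [::] u 1].

(** Two candidates for front [p']: deleting the whole block at cost [bl] leaves the front at [J];
    aligning it with y from [J] to [j] costs [bl - l] and moves the front to [j.+1]. *)
Definition improve p bl j l J (J' : seq nat) p' :=
  let v := if grid p + bl <= grid p' then minn (front J' p') J else front J' p' in
  if (J <= j) && (grid p + bl <= grid p' + l) then minn v j.+1 else v.

(** y is scanned once per old front, [p] being the scan and [j] the position, so that a single row
    is kept. The row restarts at the front as the empty list, whose default value 0 is the value
    against an empty string. *)
Definition front_pass (m z : nat) (bits : bitseq) (u : state) : state :=
  let p := z %/ n in let j := z %% n in
  let J := front (nth [::] u 2) p in
  let row := if j < J then nth [::] u 0 else
    next_row (if j == J then [::] else nth [::] u 0) bits in
  [:: row;
      mkseq (improve p (size bits) j (nth 0 row (size bits)) J (nth [::] u 1)) P;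
      nth [::] u 2].

Definition front_out (u : state) : nat := grid (find (geq n) (nth [::] u 1)).

Variables (T : eqType) (x y : seq T).
Hypotheses (b_gt0 : 0 < b) (N_gt0 : 0 < N) (n_gt0 : 0 < n).
Hypotheses (sz_x : size x = n) (sz_y : size y = n).
Hypothesis le_grid : 2 * n <= grid P.-1.
Hypothesis P_gt0 : 0 < P.

Local Notation block := (x_block b x).
Local Notation matches := (xy_matches n b x y).
Local Notation passes := (passes n b front_pass x y).

(** The last three clauses are soundness (each finite new front comes from an old one) and
    completeness: the passes done so far have offered the deletion of the whole block and every
    alignment ending at a symbol already scanned. *)
Definition front_inv m (Jold : seq nat) k (u : state) := exists row Jnew,
  [/\ u = [:: row; Jnew; Jold],
      size row <= b.+1 /\ all (geq b) row,
      size Jnew <= P /\ all (geq n.+1) Jnew,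
      front Jold (k %/ n) < k %% n -> forall a, a <= size (block m) ->
        nth 0 row a =
          lcs (take a (block m)) (drop (front Jold (k %/ n)) (take (k %% n) y)) &
  [/\
      forall p', p' < P -> front Jnew p' <= n -> exists p,
        [/\ p < P, front Jold p <= front Jnew p' &
            grid p + size (block m) <= grid p' +
              lcs (block m) (drop (front Jold p) (take (front Jnew p') y))],
      forall z p', z < k -> p' < P -> grid (z %/ n) + size (block m) <= grid p' ->
        front Jnew p' <= front Jold (z %/ n) &
      forall z p', z < k -> p' < P -> front Jold (z %/ n) <= z %% n ->
        grid (z %/ n) + size (block m) <= grid p' +
          lcs (block m) (drop (front Jold (z %/ n)) (take (z %% n).+1 y)) ->
        front Jnew p' <= (z %% n).+1]].

Lemma improve_le p bl j l J J' p' : improve p bl j l J J' p' <= front J' p'.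
Proof. by rewrite /improve; do 2![case: ifP => _]; rewrite ?geq_min ?leqnn //; lia. Qed.

Lemma front_inv_step m Jold k u : k < P * n -> all (geq n.+1) Jold ->
  front_inv m Jold k u ->
  front_inv m Jold k.+1 (front_pass m k (matches m k) u).
Proof.
move=> lt_k Jold_le [row [Jnew [-> [sz_row le_row] [sz_J le_J] rowE [sound compl0 compl]]]].
rewrite /front_pass /=; set p := k %/ n; set j := k %% n; set J := front Jold p.
set X := block m.
have sz_m : size (matches m k) = size X by rewrite size_map.
have lt_pP : p < P by rewrite ltn_divLR.
have lt_jn : j < n by rewrite ltn_mod.
have front_le s p' : all (geq n.+1) s -> front s p' <= n.+1.
  move=> s_le; rewrite /front; case: (ltnP p' (size s)) => [lt_p'|?].
    by move/all_nthP: s_le; apply.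
  by rewrite nth_default.
have le_X : size X <= b by rewrite size_take_min geq_minl.
set row' := if j < J then row else _.
have row'E : J <= j -> forall a, a <= size X ->
    nth 0 row' a = lcs (take a X) (drop J (take j.+1 y)).
  move=> le_Jj a le_aX; rewrite /row' ltnNge le_Jj /=.
  have [v Ev] : exists v, onth y j = Some v.
    by case E: (onth y j) => [v|]; [exists v | have := onthTE y j; rewrite E sz_y lt_jn].
  have -> : matches m k = [seq d == v | d <- X].
    by apply: eq_map => d; rewrite -/j Ev.
  rewrite (take_nth v) ?sz_y // (onth_nth _ _ _ _ Ev) drop_rcons; last first.
    by rewrite size_takel // sz_y ltnW.
  apply: next_rowE => // a' le_a'X; case: ltngtP le_Jj => // [lt_Jj | ->] _.
    exact: rowE.
  by rewrite drop_oversize ?nth_nil ?lcs_nilr // size_take_min geq_minl.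
have row'_ok : size row' <= b.+1 /\ all (geq b) row'.
  case: (ltnP j J) => [lt_jJ|le_Jj]; first by rewrite /row' lt_jJ.
  have sz_row' : size row' = (size X).+1.
    by rewrite /row' ltnNge le_Jj size_mkseq sz_m.
  split; first by rewrite sz_row' ltnS.
  apply/(all_nthP 0) => a; rewrite sz_row' ltnS => le_a /=.
  rewrite row'E //; apply: leq_trans (lcs_sizel _ _) _.
  by rewrite size_takel // (leq_trans le_a).
set Jnew' := mkseq _ P.
have Jnew'E p' : p' < P -> front Jnew' p' =
    improve p (size X) j (nth 0 row' (size X)) J Jnew p'.
  by move=> lt_p'; rewrite /front nth_mkseq ?sz_m.
have Jnew'_le p' : p' < P -> front Jnew' p' <= front Jnew p'.
  by move=> lt_p'; rewrite Jnew'E // improve_le.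
exists row', Jnew'; split=> //.
- rewrite size_mkseq leqnn; split=> //; apply/(all_nthP n.+1) => p'.
  rewrite size_mkseq => lt_p'; rewrite -/(front _ _) /=.
  exact: leq_trans (Jnew'_le _ lt_p') (front_le _ _ le_J).
- have [def_j1 | lt_j1] : j.+1 = n \/ j.+1 < n by lia.
    have -> : k.+1 %% n = 0.
      by rewrite -addn1 -modnDml addn1 -/j def_j1 modnn.
    by rewrite ltn0.
  have -> : k.+1 %% n = j.+1 by rewrite -addn1 -modnDml addn1 -/j modn_small.
  have -> : k.+1 %/ n = p.
    by rewrite {1}(divn_eq k n) -/j -addnS divnMDl // (divn_small lt_j1) addn0.
  by rewrite ltnS => le_Jj a le_a; rewrite row'E.
split.
- move=> p' lt_p'; rewrite Jnew'E // /improve.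
  set v := if _ then minn _ J else _.
  have sound_v : v <= n -> exists p0, [/\ p0 < P, front Jold p0 <= v &
      grid p0 + size X <= grid p' + lcs X (drop (front Jold p0) (take v y))].
    rewrite /v; case: ifP => [le_pp' | _]; last exact: sound.
    rewrite /minn; case: ltnP => _; first exact: sound.
    by move=> _; exists p; split=> //; apply: leq_trans (leq_addr _ _).
  case: ifP => // /andP[le_Jj le_pp'].
  rewrite /minn; case: ltnP => _ // _; exists p; split=> //; first exact: leqW.
  by move: le_pp'; rewrite row'E // take_size.
- move=> z p'; rewrite ltnS leq_eqVlt => /orP[/eqP->|lt_zk] lt_p' le_pp'.
    rewrite -/p -/J in le_pp' *.
    by rewrite Jnew'E // /improve le_pp'; case: ifP => _; lia.
  exact: leq_trans (Jnew'_le _ lt_p') (compl0 _ _ lt_zk lt_p' le_pp').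
move=> z p'; rewrite ltnS leq_eqVlt => /orP[/eqP->|lt_zk] lt_p' le_Jz le_pp'.
  rewrite Jnew'E // /improve -/J -/j le_Jz row'E // take_size le_pp' /=; lia.
exact: leq_trans (Jnew'_le _ lt_p') (compl _ _ lt_zk lt_p' le_Jz le_pp').
Qed.

Lemma front_inv_passes m Jold k u : k <= P * n -> all (geq n.+1) Jold ->
  front_inv m Jold 0 u -> front_inv m Jold k (passes m k u).
Proof.
move=> le_k le_J inv_u; elim: k le_k => // k IHk lt_k.
by rewrite passesS; apply: front_inv_step => //; apply/IHk/ltnW.
Qed.

(** Soundness of the finite fronts, and completeness up to the factor (1 + 1 / N)^m lost in [m]
    blocks, with denominators cleared. *)
Definition fronts_ok m J :=
  [/\ size J <= P /\ all (geq n.+1) J,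
      forall p, p < P -> front J p <= n ->
        size (take (m * b) x) <= grid p + lcs (take (m * b) x) (take (front J p) y) &
      forall j v, j <= n -> v <= n ->
        size (take (m * b) x) <= v + lcs (take (m * b) x) (take j y) ->
        exists p, [/\ p < P, front J p <= j & N ^ m * grid p <= N.+1 ^ m * v]].

Lemma front_inv0 m J : front_inv m J 0 [:: [::]; [::]; J].
Proof.
exists [::], [::]; rewrite !div0n mod0n; split=> //; split=> // p' _.
by rewrite /front nth_nil ltnn.
Qed.

Lemma takeSb m : take (m.+1 * b) x = take (m * b) x ++ block m.
Proof. by rewrite mulSnr takeD. Qed.

Lemma fronts_okS m u : fronts_ok m (nth [::] u 1) -> 2 * m.+1 <= N ->
  fronts_ok m.+1 (nth [::] (passes m (P * n) (front_start m 0 u)) 1).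
Proof.
set Jold := nth [::] u 1 => -[[sz_J le_J] sound compl] le_N.
have := front_inv_passes (leqnn _) le_J (front_inv0 m Jold).
case=> row [J [-> _ [sz_J' le_J'] _ [snd cpl0 cpl]]] /=.
split=> // [p' lt_p' le_n | j v le_jn le_vn].
  have [p [lt_p le_pp' le_grid_p]] := snd _ lt_p' le_n.
  have := sound _ lt_p (leq_trans le_pp' le_n).
  have := lcs_cat (take (m * b) x) (block m) (take (front Jold p) y)
    (drop (front Jold p) (take (front J p') y)).
  rewrite -{2}(take_takel y le_pp') cat_take_drop -takeSb takeSb size_cat -takeSb; lia.
(* An alignment of the longer prefix is cut at the border of the block; [v0] and [v1] are the
   deletions on either side. *)
have [j0 le_j0] := lcs_split (take (m * b) x) (block m) (take j y).
rewrite size_takel ?sz_y // in le_j0.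
rewrite take_takel // takeSb size_cat.
set l0 := lcs _ (take j0 y); set l1 := lcs _ (drop j0 _) => le_l le_v.
have le_l0 : l0 <= size (take (m * b) x) by apply: lcs_sizel.
have le_l1 : l1 <= size (block m) by apply: lcs_sizel.
pose v0 := size (take (m * b) x) - l0; pose v1 := size (block m) - l1.
have le_v01 : v0 + v1 <= v by rewrite /v0 /v1; lia.
have [|||p [lt_p le_p le_grid_p]] := compl j0 v0.
- exact: leq_trans le_jn.
- lia.
- by rewrite /v0 -/l0; lia.
(* As m is at most N / 2, the loss so far is at most a factor 2. The cost to be rounded is then at
   most 2 n, which is why the grid must reach 2 n. *)
have exp_le : N.+1 ^ m <= 2 * N ^ m.
  have := bernoulli N_gt0 m; rewrite expnS => le_m.
  have : N * N.+1 ^ m <= N * (2 * N ^ m) by nia.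
  by rewrite leq_pmul2l.
have grid_p2 : grid p <= 2 * v0.
  have : N ^ m * grid p <= N ^ m * (2 * v0).
    by apply: leq_trans le_grid_p _; nia.
  by rewrite leq_pmul2l // expn_gt0 N_gt0.
have [|p' [lt_p' le_p' grid_p']] := @grid_round N N_gt0 P.-1 (grid p + v1).
  by apply: leq_trans le_grid; lia.
have {}lt_p' : p' < P by rewrite -(prednK P_gt0) ltnS.
exists p'; split=> //.
  (* The front found is at most [j0], so it leaves the block at least as much of y as the cut
     alignment does. *)
  have cpl_p : grid p + size (block m) <= grid p' +
      lcs (block m) (drop (front Jold p) (take j y)).
    have : l1 <= lcs (block m) (drop (front Jold p) (take j y)).
      apply: lcs_sub => //; rewrite -(subnK le_p) -drop_drop.
      exact: drop_subseq.
    rewrite /v1 in le_p'; lia.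
  (* Below [j], the pass for symbol [j.-1] of y gives the alignment. At [j], nothing of y is left
     for the block, which is deleted as a whole. *)
  case: (ltngtP (front Jold p) j) (leq_trans le_p le_j0) => // [lt_pj | def_j] _.
    have lt_j1 : j.-1 < n by lia.
    have lt_z : p * n + j.-1 < P * n by nia.
    have Ediv : (p * n + j.-1) %/ n = p by rewrite divnMDl // divn_small // addn0.
    have Emod : (p * n + j.-1) %% n = j.-1 by rewrite modnMDl modn_small.
    have := cpl _ p' lt_z lt_p'; rewrite Ediv Emod prednK; last by lia.
    by apply=> //; lia.
  have lt_z : p * n < P * n by rewrite ltn_mul2r n_gt0.
  have := cpl0 _ p' lt_z lt_p'; rewrite mulnK // def_j; apply.
  move: cpl_p; rewrite def_j drop_oversize ?lcs_nilr ?addn0 //.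
  by rewrite size_take_min geq_minl.
have le2 : N ^ m <= N.+1 ^ m by case: (m) => // m'; rewrite leq_exp2r.
rewrite !expnS; move: (N ^ m) (N.+1 ^ m) le_grid_p le2 {exp_le} => e f le_p1 le_ef.
have le3 : e * (grid p + v1) <= f * v.
  apply: leq_trans (_ : f * (v0 + v1) <= _); last by rewrite leq_mul2l le_v01 orbT.
  by rewrite !mulnDr leq_add // leq_mul2r le_ef orbT.
apply: leq_trans (_ : N.+1 * (e * (grid p + v1)) <= _).
  by rewrite [N * e]mulnC -mulnA [leqRHS]mulnCA leq_mul2l grid_p' orbT.
by rewrite -mulnA leq_mul2l le3 orbT.
Qed.

Local Notation before := (before n b (P * n) front_init front_start front_pass x y).
Local Notation during := (during n b (P * n) front_init front_start front_pass x y).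

Lemma fronts_ok_before om m : 2 * m <= N -> fronts_ok m (nth [::] (before om m) 1).
Proof.
elim: m => [|m IHm] le_m; last first.
  by apply: fronts_okS => //; apply: IHm; lia.
split=> // [p _ _ | j v _ _ _]; first by rewrite mul0n take0.
by exists 0; split; rewrite ?muln0.
Qed.

(** The first finite front is sound. Completeness for an optimal alignment bounds its cost by (1 + 1
    / N)^nb times the distance, and [bernoulli] turns this factor into N / (N - nb). *)
Lemma front_out_approx om nb : n <= nb * b -> 2 * nb <= N ->
  let v := front_out (before om nb) in
  edit_dist x y <= v /\ (N - nb) * v <= N * edit_dist x y.
Proof.
move=> le_n le_nb; have [[sz_J le_J] sound compl] := fronts_ok_before om le_nb.
rewrite /front_out; set J := nth _ _ 1 in sz_J le_J sound compl *.
have all_x : take (nb * b) x = x by rewrite take_oversize ?sz_x.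
rewrite all_x in sound compl.
have le_l : lcs x y <= n by rewrite -sz_x lcs_sizel.
have [||p [lt_p le_pn grid_p]] := compl n (edit_dist x y) (leqnn n).
- by rewrite /edit_dist sz_x leq_subr.
- by rewrite take_oversize ?sz_y // subnK // sz_x.
have lt_pJ : p < size J.
  by rewrite ltnNge; apply/negP => ?; rewrite /front nth_default ?ltnn in le_pn.
have has_J : has (geq n) J by apply/(has_nthP n.+1); exists p.
have le_vp : find (geq n) J <= p.
  by rewrite leqNgt; apply/negP => /(before_find n.+1)/= /negP[].
have lt_vP : find (geq n) J < P by rewrite (leq_ltn_trans le_vp).
split.
  have /= le_v := nth_find n.+1 has_J.
  have le_lcs : lcs x (take (front J (find (geq n) J)) y) <= lcs x y.
    by rewrite lcs_sub ?take_subseq.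
  by rewrite /edit_dist; have := sound _ lt_vP le_v; lia.
apply: leq_trans (_ : (N - nb) * grid p <= _).
  by rewrite leq_mul2l grid_mono ?orbT.
have := bernoulli N_gt0 nb; rewrite expnS => bern.
have : N ^ nb * ((N - nb) * grid p) <= N ^ nb * (N * edit_dist x y).
  rewrite mulnCA (leq_trans (leq_mul (leqnn _) grid_p)) // mulnA.
  by rewrite [_ * N.+1 ^ nb]mulnC [leqRHS]mulnA [_ * N]mulnC leq_mul.
by rewrite leq_pmul2l // expn_gt0 N_gt0.
Qed.

Lemma front_during_size om m z : z <= P * n -> 2 * m <= N -> exists row J J',
  [/\ during om m z = [:: row; J; J'], size row <= b.+1 /\ all (geq b) row,
      size J <= P /\ all (geq n.+1) J & size J' <= P /\ all (geq n.+1) J'].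
Proof.
have in_passes m' k : k <= P * n -> 2 * m' <= N -> exists row J J',
  [/\ passes m' k (front_start m' (om m') (before om m')) = [:: row; J; J'],
      size row <= b.+1 /\ all (geq b) row, size J <= P /\ all (geq n.+1) J
    & size J' <= P /\ all (geq n.+1) J'].
  move=> le_k le_m'; have [[sz_J le_J] _ _] := fronts_ok_before om le_m'.
  have [row [J [-> rowP JP _ _]]] := front_inv_passes le_k le_J (front_inv0 m' _).
  by exists row, J, (nth [::] (before om m') 1).
case: z => [_ | z lt_z le_m]; last by apply: in_passes; rewrite // ltnW.
case: m => [_ | m le_m]; last by apply: in_passes; lia.
by exists [::], [:: 0], [::].
Qed.

End FrontAlgorithm.

Definition front_machine n b N P : algorithm :=
  block_machine n b (P * n) (n %/ b).+1 false front_init front_start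
    (front_pass n N P) (front_out n N).

Lemma front_machine_correct (R : realType) n b N P (T : eqType) (x y : seq T)
    (s : R) :
  1 < n -> 0 < b <= n -> 2 * (n %/ b).+1 <= N -> 2 * n <= grid N P.-1 ->
  0 < P <= (2 * n).+1 -> size x = n -> size y = n ->
  ((3 * b + 2 * P + 14)%:R <= s)%R ->
  runs_in_space (front_machine n b N P) x y (n ^ 4) s /\
  exists2 v, computes (front_machine n b N P) x y v &
    edit_dist x y <= v /\ (N - (n %/ b).+1) * v <= N * edit_dist x y.
Proof.
move=> n_gt1 /andP[b_gt0 le_bn] le_N le_grid /andP[P_gt0 le_P] sz_x sz_y le_s.
have n_gt0 : 0 < n by apply: ltnW.
have N_gt0 : 0 < N by apply: leq_trans le_N.
(* The pass number reaches [P * n], at most (2 n + 1) n; it has to stay below the word bound. *)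
have lt_n_q : n * n * 4 <= n ^ 4.
  by rewrite -[4]/(2 + 2) expnD -mulnn leq_mul // (leq_mul n_gt1 n_gt1).
have le_4 : 4 <= n * n by apply: (leq_mul n_gt1 n_gt1).
have le_n2 : 2 * n <= n * n by rewrite leq_mul.
have le_nb : n %/ b <= n by apply: leq_div.
have nb_b : n <= (n %/ b).+1 * b.
  by rewrite mulSn addnC {1}(divn_eq n b) leq_add2l ltnW // ltn_mod.
rewrite /front_machine; move: (n %/ b) le_N le_nb nb_b => nb le_N le_nb nb_b.
split.
  apply: (@block_machine_space _ _ _ _ _ _ _ _ _ _ _ _ b_gt0 sz_x sz_y n_gt0
            _ _ (3 + (b + 1 + 2 * P))) => //; [lia | nia | lia | lia | | ].
    move=> om m z _ le_m le_z.
    have {}le_m : m <= nb.+1 by case/orP: le_m => [/ltnW | /andP[/eqP->]].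
    have [|row [J [J' [-> [sz_row row_b] [sz_J J_n] [sz_J' J'_n]]]]] :=
      @front_during_size n b N P T x y b_gt0 N_gt0 n_gt0 sz_x sz_y le_grid P_gt0
        om m z le_z; first by lia.
    have lt_n1 : n.+1 < n ^ 4 by lia.
    have all_q (s' : seq nat) k : all (geq k) s' -> k < n ^ 4 -> all (gtn (n ^ 4)) s'.
      move=> /allP s'_k lt_k; apply/allP => i /s'_k /= le_ik; exact: leq_ltn_trans lt_k.
    rewrite /= !all_cat /= (all_q _ _ row_b) ?(all_q _ _ J_n) ?(all_q _ _ J'_n) //; last lia.
    split; lia.
  by apply: le_trans le_s; rewrite ler_nat; lia.
pose k := clock b (P * n) nb.+1 0 0 + 2.
exists (front_out n N (before n b (P * n) front_init front_start
          (front_pass n N P) x y (fun=> 0) nb.+1)).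
  by exists k; rewrite (@block_machine_answer _ _ _ _ _ _ _ _ _ _ _ _
    b_gt0 sz_x sz_y n_gt0) // size_nseq.
exact: front_out_approx.
Qed.

(** * The randomized algorithm *)

Lemma sorted_gap (s : seq nat) i j : sorted ltn s -> i <= j < size s ->
  nth 0 s i + (j - i) <= nth 0 s j.
Proof.
move=> sorted_s /andP[/subnKC <-]; rewrite addKn.
elim: (j - i) => [|k IHk] lt_k; first by rewrite !addn0.
have lt_k' : i + k < size s by lia.
rewrite addnS; apply: leq_ltn_trans (IHk lt_k') _.
by rewrite (sorted_ltn_nth ltn_trans) ?inE // addnS.
Qed.

Lemma sorted_ge (s : seq nat) i : sorted ltn s -> i < size s -> i <= nth 0 s i.
Proof.
by move=> ss lt_i; have := @sorted_gap s 0 i ss lt_i; rewrite subn0; lia.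
Qed.

Lemma sumn_shape_le (T : eqType) (L : seq (seq T)) c :
  (forall e, e \in L -> size e <= c) -> sumn (shape L) <= size L * c.
Proof.
elim: L => //= e L IHL le_c; rewrite mulSn leq_add ?le_c ?mem_head //.
by apply: IHL => e' e'_L; rewrite le_c // inE e'_L orbT.
Qed.

(* Each symbol of x is remembered for a random time: a symbol read at time i
   with random word r is forgotten at the first t with r * (t - i) >= K * q, that
   is, it survives until t with probability about K / (t - i).  An entry
   [:: i; r & pts] of the state remembers the symbol number i of x by its matches
   with y: a match with position j in y which ends a chain of l remembered
   matches is stored as the number j * n.+1 + l.  The state starts with the
   length of the longest chain found, followed by the entries, the latest first. *)
Section ChainAlgorithm.
Variables (n K M q : nat).
Local Notation state := (seq (seq nat)).

Definition survives r i t := r * (t - i) < K * q.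

Definition alive t (e : seq nat) := survives (nth 0 e 1) (nth 0 e 0) t.

Definition chain_init : state := [:: [:: 0]].

(** The cap [M] makes the space bound hold for all random words; overflow then only counts as a
    possible error. *)
Definition chain_start (m r : nat) (u : state) : state :=
  [:: head [::] u, [:: m; r] & take M [seq e <- behead u | alive m e]].

Definition chain_len (L : state) j :=
  (\max_(e <- L) \max_(p <- drop 2 e | p %/ n.+1 < j) p %% n.+1).+1.

(** The entry [e] under construction is left out of [chain_len], so a chain uses each symbol of x at
    most once. *)
Definition chain_pass (m z : nat) (bits : bitseq) (u : state) : state :=
  if u is best :: e :: L then
    if head false bits then
      [:: [:: maxn (head 0 best) (chain_len L z)],
          rcons e (z * n.+1 + chain_len L z) & L]
    else u
  else u.

Definition chain_out (u : state) : nat := n - head 0 (head [::] u).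

Variables (T : eqType) (x y : seq T).
Hypotheses (n_gt0 : 0 < n) (sz_x : size x = n) (sz_y : size y = n).

Local Notation block := (x_block 1 x).
Local Notation matches := (xy_matches n 1 x y).
Local Notation passes := (passes n 1 chain_pass x y).
Local Notation before := (before n 1 n chain_init chain_start chain_pass x y).
Local Notation during := (during n 1 n chain_init chain_start chain_pass x y).

Definition hits m k := [seq z <- iota 0 k | onth x m == onth y z].

Definition best_chain om m := head 0 (head [::] (before om m)).
Definition entries om m := behead (before om m).
Definition older om m := take M [seq e <- entries om m | alive m e].
Definition new_entry om m k :=
  [:: m, om m & [seq z * n.+1 + chain_len (older om m) z | z <- hits m k]].
Definition new_best om m k :=
  maxn (best_chain om m) (\max_(z <- hits m k) chain_len (older om m) z).

Lemma head_matches m z : m < n -> z < n ->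
  head false (matches m z) = (onth x m == onth y z).
Proof.
move=> lt_m lt_z; have [d _] : exists d : T, true.
  by move: lt_m; rewrite -sz_x; case: (x) => // d; exists d.
have lt_mx : m < size x by rewrite sz_x.
rewrite /xy_matches /x_block muln1 (drop_nth d) //=.
by rewrite modn_small ?(onth_some d lt_mx).
Qed.

Lemma hitsS m k : hits m k.+1 =
  if onth x m == onth y k then rcons (hits m k) k else hits m k.
Proof.
by rewrite /hits -addn1 iotaD filter_cat /= add0n; case: ifP; rewrite ?cats0 ?cats1.
Qed.

Lemma passes_form om m k : before om m = [:: best_chain om m] :: entries om m ->
  m < n -> k <= n ->
  passes m k (chain_start m (om m) (before om m)) =
    [:: [:: new_best om m k], new_entry om m k & older om m].
Proof.
move=> -> lt_m; elim: k => [|k IHk] lt_k.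
  by rewrite /chain_start /new_best /new_entry /hits /= big_nil maxn0.
rewrite passesS IHk; last exact: ltnW.
rewrite /chain_pass head_matches // /new_best /new_entry hitsS.
case: ifP => // _; rewrite big_rcons map_rcons /=.
by rewrite maxnA.
Qed.

Lemma before_form om m : m <= n ->
  before om m = [:: best_chain om m] :: entries om m.
Proof.
elim: m => // m IHm lt_m; rewrite /best_chain /entries /=.
by rewrite passes_form // IHm // ltnW.
Qed.

Lemma during_form om m k : m < n -> k <= n -> during om m k.+1 =
  [:: [:: new_best om m k], new_entry om m k & older om m].
Proof. by move=> lt_m le_k; rewrite /= passes_form // before_form // ltnW. Qed.

Lemma entriesS om m : m < n -> entries om m.+1 = new_entry om m n :: older om m.
Proof. by move=> lt_m; have := during_form om lt_m (leqnn n); rewrite /entries /= => ->. Qed.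

Lemma best_chainS om m : m < n -> best_chain om m.+1 = new_best om m n.
Proof. by move=> lt_m; have := during_form om lt_m (leqnn n); rewrite /best_chain /= => ->. Qed.

Lemma mem_older om m e : e \in older om m -> e \in entries om m /\ alive m e.
Proof. by move=> /mem_take; rewrite mem_filter => /andP[]. Qed.

Definition sound_entry m e := forall p, p \in drop 2 e ->
  p %% n.+1 <= lcs (take m x) (take (p %/ n.+1).+1 y) /\ p %/ n.+1 < n.

Lemma mem_hits m k z : z \in hits m k = (z < k) && (onth x m == onth y z).
Proof. by rewrite mem_filter mem_iota andbC. Qed.

(** A match adds one to a common subsequence of strictly shorter prefixes, by [lcs_rcons]. *)
Lemma chain_len_sound om m z :
    (forall e, e \in entries om m -> sound_entry m e) -> m < n ->
  z \in hits m n -> chain_len (older om m) z <= lcs (take m.+1 x) (take z.+1 y).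
Proof.
move=> sound_m lt_m; rewrite mem_hits => /andP[lt_z /eqP eq_xy].
have lt_mx : m < size x by rewrite sz_x.
have lt_zy : z < size y by rewrite sz_y.
have [d _] : exists d : T, true by case: (x) lt_mx => // d; exists d.
rewrite (take_nth d lt_mx) (take_nth d lt_zy) lcs_rcons.
move: eq_xy; rewrite (onth_some d lt_mx) (onth_some d lt_zy) => -[->].
rewrite eqxx ltnS; apply/bigmax_leqP_seq => e /mem_older[e_m _] _.
apply/bigmax_leqP_seq => p p_e lt_pz; have [le_p _] := sound_m e e_m p p_e.
by apply: leq_trans le_p _; apply: lcs_take_le.
Qed.

Lemma lcs_le_n i j : lcs (take i x) (take j y) <= n.
Proof. by rewrite -sz_x (leq_trans (lcs_sizel _ _)) // size_take_min geq_minr. Qed.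

(** Soundness keeps chain lengths at most [n], so division by [n.+1] recovers both components. *)
Lemma match_numberK om m z (p := z * n.+1 + chain_len (older om m) z) :
    (forall e, e \in entries om m -> sound_entry m e) -> m < n ->
  z \in hits m n -> p %/ n.+1 = z /\ p %% n.+1 = chain_len (older om m) z.
Proof.
move=> sound_m lt_m z_hit; rewrite /p divnMDl // modnMDl.
have lt_l : chain_len (older om m) z < n.+1.
  by rewrite ltnS (leq_trans (chain_len_sound sound_m lt_m z_hit)) ?lcs_le_n.
by rewrite divn_small // addn0 modn_small.
Qed.

Lemma entries_sound om m : m <= n -> forall e, e \in entries om m -> sound_entry m e.
Proof.
elim: m => // m IHm lt_m; have {}IHm := IHm (ltnW lt_m).
move=> e; rewrite entriesS // inE => /orP[/eqP-> | /mem_older[e_m _]] p.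
  rewrite /new_entry /= drop0 => /mapP[z z_hit ->].
  have [-> ->] := match_numberK IHm lt_m z_hit.
  by rewrite chain_len_sound //; move: z_hit; rewrite mem_hits => /andP[].
move=> p_e; have [le_p ->] := IHm e e_m p p_e; split=> //.
by apply: leq_trans le_p _; apply: lcs_take_le.
Qed.

Lemma best_chain_le om m : m <= n -> best_chain om m <= lcs x y.
Proof.
elim: m => [|m IHm] lt_m; first by rewrite /best_chain.
rewrite best_chainS // geq_max IHm ?(ltnW lt_m) //=.
apply/bigmax_leqP_seq => z z_hit _.
apply: leq_trans (chain_len_sound (entries_sound (ltnW lt_m)) lt_m z_hit) _.
by apply: lcs_sub; apply: take_subseq.
Qed.

Lemma mem_entries om m e : m <= n -> e \in entries om m ->
  exists2 i, i < m & e = new_entry om i n.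
Proof.
elim: m => // m IHm lt_m; rewrite entriesS // inE => /orP[/eqP-> | ].
  by exists m.
by case/mem_older=> /(IHm (ltnW lt_m))[i lt_i ->] _; exists i; rewrite // ltnW.
Qed.

(** The matches of a symbol of x are its occurrences in y; this brings [max_occ] into the space
    bound. *)
Lemma size_hits m k : m < n -> k <= n -> size (hits m k) <= max_occ y.
Proof.
move=> lt_m le_k; have lt_mx : m < size x by rewrite sz_x.
have [d _] : exists d : T, true by case: (x) lt_mx => // d; exists d.
set a := nth d x m; apply: leq_trans (_ : count_mem a y <= _).
  rewrite size_filter -[in leqRHS](take_size y) -(map_nth_iota0 d (leqnn _)) sz_y.
  rewrite count_map -(subnKC le_k) iotaD count_cat; apply: leq_trans (leq_addr _ _).
  rewrite (@eq_in_count _ _ (preim (nth d y) (pred1 a))) // => z.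
  rewrite mem_iota add0n => /= lt_z; have lt_zn := leq_trans lt_z le_k.
  by rewrite (onth_some d lt_mx) (onth_some d) ?sz_y // eq_sym.
have [a_y|/count_memPn -> //] := boolP (a \in y).
exact: (@leq_bigmax_seq _ _ xpredT (fun a => count_mem a y)).
Qed.

Lemma size_entries om m : m <= n -> size (entries om m) <= m.
Proof.
elim: m => // m IHm lt_m; rewrite entriesS //= ltnS.
apply: leq_trans (IHm (ltnW lt_m)).
by rewrite size_take_min size_filter geq_min count_size orbT.
Qed.

Lemma size_older om m : m <= n -> size (older om m) <= minn M m.
Proof.
move=> le_m; rewrite size_take_min leq_min geq_minl /=.
rewrite (leq_trans (geq_minr _ _)) // size_filter (leq_trans (count_size _ _)) //.
exact: size_entries.
Qed.

Lemma chain_state_size om m k : n * n.+1 <= q -> (forall i, om i < q) ->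
  m < n -> k <= n ->
  let L := new_entry om m k :: older om m in
  [/\ new_best om m k <= n, size L <= (minn M m).+1 &
      all (fun e => (size e <= 2 + max_occ y) && all (gtn q) e) L].
Proof.
move=> le_q om_q lt_m le_k L; have lt_nq : n < q by nia.
have new_ok i k' : i < n -> k' <= n ->
    (size (new_entry om i k') <= 2 + max_occ y) && all (gtn q) (new_entry om i k').
  move=> lt_i le_k'; rewrite /= size_map !ltnS size_hits // om_q (ltn_trans lt_i) //=.
  apply/allP=> _ /mapP[z z_hit ->] /=.
  have lt_z : z < n by move: z_hit; rewrite mem_hits => /andP[/leq_trans-> ].
  have z_hit' : z \in hits i n by move: z_hit; rewrite !mem_hits lt_z => /andP[].
  have := chain_len_sound (@entries_sound om _ (ltnW lt_i)) lt_i z_hit'.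
  move/leq_trans/(_ (lcs_le_n _ _)) => le_c.
  by apply: leq_trans le_q; nia.
split.
- rewrite geq_max (leq_trans (best_chain_le _ (ltnW lt_m))) -?sz_x ?lcs_sizel //=.
  apply/bigmax_leqP_seq => z; rewrite mem_hits => /andP[lt_z z_hit] _.
  rewrite sz_x; apply: leq_trans (lcs_le_n m.+1 z.+1).
  apply: chain_len_sound (entries_sound (ltnW lt_m)) lt_m _.
  by rewrite mem_hits (leq_trans lt_z).
- by rewrite ltnS size_older // ltnW.
apply/andP; split; first exact: new_ok.
apply/allP=> e /mem_older[/(mem_entries (ltnW lt_m))[i lt_i ->] _].
by apply: new_ok => //; apply: ltn_trans lt_m.
Qed.

(** * Length of the chain found when enough symbols are remembered *)

Section Completeness.
Variable om : nat -> nat.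
Hypothesis le_M : forall t, t < n ->
  count (fun i => survives (om i) i t) (iota 0 t) <= M.

Lemma survivesS r i t : survives r i t.+1 -> survives r i t.
Proof. by apply: leq_ltn_trans; rewrite leq_mul2l leq_sub2r ?orbT. Qed.

(** By [le_M] the cap never truncates, and survival is monotone in time, so discarding dead entries
    step by step leaves exactly the survivors. *)
Lemma older_all m : m < n ->
  [seq (nth 0 e 0, nth 0 e 1) | e <- older om m] =
  rev [seq (i, om i) | i <- iota 0 m & survives (om i) i m].
Proof.
have olderE m' : m' < n ->
    [seq (nth 0 e 0, nth 0 e 1) | e <- entries om m' & alive m' e] =
    rev [seq (i, om i) | i <- iota 0 m' & survives (om i) i m'] ->
    [seq (nth 0 e 0, nth 0 e 1) | e <- older om m'] =
    rev [seq (i, om i) | i <- iota 0 m' & survives (om i) i m'].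
  move=> lt_m' E; rewrite /older take_oversize //.
  by rewrite -(size_map (fun e => (nth 0 e 0, nth 0 e 1))) E size_rev size_map
     size_filter le_M.
elim: m => [|m IHm] lt_m; apply: olderE => //.
have lt_m' := ltnW lt_m; rewrite entriesS //.
have E s : [seq (nth 0 e 0, nth 0 e 1) | e <- s & alive m.+1 e] =
   [seq p <- [seq (nth 0 e 0, nth 0 e 1) | e <- s] | survives p.2 p.1 m.+1].
  by rewrite filter_map.
rewrite E map_cons IHm // -addn1 iotaD add0n addn1 filter_cat map_cat rev_cat /=.
rewrite filter_rev filter_map -filter_predI /=.
rewrite (@eq_filter _ _ (fun i => survives (om i) i m.+1)) => [|i]; last first.
  by rewrite /=; apply/andb_idr/survivesS.
by case: ifP.
Qed.

Variables (D : nat) (I J : seq nat).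
Local Notation l := (lcs x y).
Hypotheses (sz_I : size I = l) (sz_J : size J = l).
Hypotheses (sorted_I : sorted ltn I) (sorted_J : sorted ltn J).
Hypotheses (I_n : all (gtn n) I) (J_n : all (gtn n) J).
Hypothesis IJ_match : forall k, k < l -> onth x (nth 0 I k) = onth y (nth 0 J k).
Hypothesis reachable : forall k, k < l -> D * k <= nth 0 I k - k \/
  exists k', [/\ k' < k, survives (om (nth 0 I k')) (nth 0 I k') (nth 0 I k)
    & D * (k - k').-1 <= nth 0 I k - nth 0 I k' - (k - k')].

Lemma I_lt k : k < l -> nth 0 I k < n.
Proof. by move=> lt_k; move/all_nthP: I_n; apply; rewrite sz_I. Qed.

Lemma J_hit k : k < l -> nth 0 J k \in hits (nth 0 I k) n.
Proof.
move=> lt_k; rewrite mem_hits IJ_match // eqxx andbT.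
by move/all_nthP: J_n; apply; rewrite sz_J.
Qed.

(** [nth 0 I k - k] counts the unmatched symbols of x before match [k]. Linking to [k'] lengthens
    the chain by one and skips [(k - k').-1] matches, paid for by the unmatched symbols in
    between. *)
Lemma chain_len_good k : k < l ->
  D * k.+1 <= D * chain_len (older om (nth 0 I k)) (nth 0 J k) + (nth 0 I k - k).
Proof.
elim/ltn_ind: k => k IHk lt_k; case: (reachable lt_k) => [le_k | [k' [lt_k' surv le_k]]].
  rewrite mulnS leq_add // leq_pmulr //.
have lt_k'l := ltn_trans lt_k' lt_k.
have := IHk k' lt_k' lt_k'l; set c' := chain_len _ _ => le_c'.
(* The symbol of match [k'] is still in memory, and its match lies earlier in y, so its chain can be
   extended. *)
have lt_c : c' < chain_len (older om (nth 0 I k)) (nth 0 J k).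
  have : (nth 0 I k', om (nth 0 I k')) \in
      [seq (nth 0 e 0, nth 0 e 1) | e <- older om (nth 0 I k)].
    rewrite older_all ?I_lt // mem_rev map_f // mem_filter surv mem_iota /=.
    by rewrite (sorted_ltn_nth ltn_trans) ?inE ?sz_I.
  case/mapP=> e e_older [id_e _].
  have [e_k _] := mem_older e_older.
  have [i _ def_e] := mem_entries (ltnW (I_lt lt_k)) e_k.
  rewrite def_e /= in id_e; rewrite -{i}id_e in def_e.
  have sound_k' := entries_sound (ltnW (I_lt lt_k'l)).
  have [div_p mod_p] := match_numberK (sound_k' om) (I_lt lt_k'l) (J_hit lt_k'l).
  rewrite /chain_len ltnS.
  apply: leq_trans (@leq_bigmax_seq _ _ xpredT (fun e => \max_(p <- drop 2 e |
    p %/ n.+1 < nth 0 J k) p %% n.+1) _ e_older isT).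
  rewrite /c' -[leqLHS]mod_p /=.
  apply: (@leq_bigmax_seq _ _ _ (fun p => p %% n.+1)).
    by rewrite def_e /= drop0; apply: map_f; apply: J_hit.
  by rewrite div_p (sorted_ltn_nth ltn_trans) ?inE ?sz_J.
have gap : nth 0 I k' + (k - k') <= nth 0 I k.
  by rewrite sorted_gap // sz_I ltnW.
have ge_k' : k' <= nth 0 I k' by rewrite sorted_ge ?sz_I.
have -> : D * k.+1 = D * k'.+1 + D * (k - k').-1 + D.
  by rewrite -mulnDr -mulnSr; congr (_ * _); lia.
have : D * c'.+1 <= D * chain_len (older om (nth 0 I k)) (nth 0 J k).
  by rewrite leq_mul2l lt_c orbT.
rewrite mulnSr; lia.
Qed.

Lemma best_chain_mono m m' : m <= m' <= n -> best_chain om m <= best_chain om m'.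
Proof.
case/andP=> /subnKC <-; elim: (m' - m) => [|k IHk]; first by rewrite addn0.
rewrite addnS => lt_k; apply: leq_trans (IHk (ltnW lt_k)) _.
by rewrite best_chainS // leq_maxl.
Qed.

(** This is [chain_len_good] at the last match, before which at most [n - l] symbols of x are
    unmatched. *)
Lemma best_chain_good : D * (l - best_chain om n) <= n - l.
Proof.
case: (posnP l) => [->|l_gt0]; first by rewrite sub0n muln0.
have lt_k : l.-1 < l by rewrite prednK.
have := chain_len_good lt_k; set c := chain_len _ _.
have le_c : c <= best_chain om n.
  apply: leq_trans (best_chain_mono (m := (nth 0 I l.-1).+1) _); last first.
    by rewrite leqnn andbT I_lt.
  rewrite best_chainS ?I_lt // leq_max; apply/orP; right.
  exact: (@leq_bigmax_seq _ _ xpredT _ _ (J_hit lt_k)).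
have : D * (l - best_chain om n) <= D * (l - c) by rewrite leq_mul2l leq_sub2l ?orbT.
have := I_lt lt_k; rewrite prednK // mulnBr; lia.
Qed.
End Completeness.
End ChainAlgorithm.

Definition chain_machine n K M q : algorithm :=
  block_machine n 1 n n true chain_init (chain_start K M q) (chain_pass n)
    (chain_out n).

Lemma chain_machine_space (R : realType) n K M (T : eqType) (x y : seq T) (s : R) :
  1 < n -> size x = n -> size y = n ->
  ((M.+1 * (max_occ y + 3) + 14)%:R <= s)%R ->
  runs_in_space (chain_machine n K M (n ^ 4)) x y (n ^ 4) s.
Proof.
move=> n_gt1 sz_x sz_y le_s; have n_gt0 : 0 < n by apply: ltnW.
have lt_n_q : n * n * 4 <= n ^ 4.
  by rewrite -[4]/(2 + 2) expnD -mulnn leq_mul // (leq_mul n_gt1 n_gt1).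
have le_4 : 4 <= n * n by apply: (leq_mul n_gt1 n_gt1).
have le_n2 : 2 * n <= n * n by rewrite leq_mul.
have le_q : n * n.+1 <= n ^ 4 by rewrite mulnS; lia.
have occ_n : max_occ y <= n.
  by apply/bigmax_leqP_seq => a _ _; rewrite -sz_y count_size.
apply: (@block_machine_space _ _ _ _ _ _ _ _ _ _ _ _ _ sz_x sz_y n_gt0
          _ _ (M.+1 * (max_occ y + 3) + 2)) => //; [lia.. | | ]; last first.
  by apply: le_trans le_s; rewrite ler_nat; lia.
move=> om m z om_q le_m le_z.
have ok_state m' k : m' < n -> k <= n ->
   let u := [:: [:: new_best n K M (n ^ 4) x y om m' k],
      new_entry n K M (n ^ 4) x y om m' k & older n K M (n ^ 4) x y om m'] in
   [/\ (size u).+2 < n ^ 4, all (gtn (n ^ 4)) (shape u ++ flatten u)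
     & size u + sumn (shape u) <= M.+1 * (max_occ y + 3) + 2].
  move=> lt_m' le_k; have [] := chain_state_size K M n_gt0 sz_x sz_y le_q om_q lt_m' le_k.
  move: (new_best _ _ _ _ _ _ _ _ _) (_ :: older _ _ _ _ _ _ _ _) => best L.
  move=> le_best sz_L /allP all_L u.
  have sum_L : sumn (shape L) <= size L * (2 + max_occ y).
    apply: sumn_shape_le => e /all_L/andP[]//.
  split; rewrite /u /=; [lia | | ].
    rewrite all_cat /= (leq_ltn_trans le_best) ?andbT; last lia.
    apply/and3P; split; [lia | | ].
      by apply/allP=> _ /mapP[e /all_L/andP[le_e _] ->] /=; lia.
    by apply/allP=> v /flattenP[e /all_L/andP[_ /allP e_q] /e_q].
  have : size L * (3 + max_occ y) <= M.+1 * (max_occ y + 3).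
    by rewrite [3 + _]addnC leq_mul2r (leq_trans sz_L) ?orbT // ltnS geq_minl.
  by rewrite addSn mulnS -/(shape L); lia.
have le_mn : m <= n by case/orP: le_m => [/ltnW | /andP[/eqP->]].
case: z le_z le_m => [|z] le_z le_m.
  case: m le_mn {le_m} => [|m] lt_m; first by split => //=; lia.
  (* The state before a block is the one after the last pass of the previous block. *)
  have -> : during n 1 n chain_init (chain_start K M (n ^ 4)) (chain_pass n)
     x y om m.+1 0 = during n 1 n chain_init (chain_start K M (n ^ 4)) (chain_pass n)
     x y om m n.+1 by [].
  by rewrite during_form //; apply: ok_state.
rewrite andbF orbF in le_m.
have le_zn := ltnW le_z; rewrite during_form //; exact: ok_state.
Qed.

Lemma chain_machine_answer n K M q D (T : eqType) (x y : seq T) (I J w : seq nat)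
    (om := tosses 1 n true (nth 0 w)) :
  0 < n -> size x = n -> size y = n -> clock 1 n n 0 0 + 2 <= size w ->
  (forall t, t < n ->
     count (fun i => survives K q (om i) i t) (iota 0 t) <= M) ->
  size I = lcs x y -> size J = lcs x y -> sorted ltn I -> sorted ltn J ->
  all (gtn n) I -> all (gtn n) J ->
  (forall k, k < lcs x y -> onth x (nth 0 I k) = onth y (nth 0 J k)) ->
  (forall k, k < lcs x y -> D * k <= nth 0 I k - k \/
    exists k', [/\ k' < k,
        survives K q (om (nth 0 I k')) (nth 0 I k') (nth 0 I k)
      & D * (k - k').-1 <= nth 0 I k - nth 0 I k' - (k - k')]) ->
  exists v, [/\ answer (run (chain_machine n K M q) x y w) = Some v,
    edit_dist x y <= v & D * (v - edit_dist x y) <= edit_dist x y].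
Proof.
move=> n_gt0 sz_x sz_y le_w le_M sz_I sz_J ss_I ss_J I_n J_n IJ reach.
have lcs_n : lcs x y <= n by rewrite -sz_x lcs_sizel.
have le_best := best_chain_le K M q sz_x sz_y om (leqnn n).
have := best_chain_good n_gt0 sz_x sz_y le_M sz_I sz_J ss_I ss_J I_n J_n IJ reach.
rewrite /edit_dist sz_x => good.
exists (n - best_chain n K M q x y om n); split.
- by rewrite /chain_machine block_machine_answer.
- exact: leq_sub2l.
by move: good; congr (_ * _ <= _); lia.
Qed.

(** * Error probability *)

Section Independence.
Local Open Scope ring_scope.
Variables (R : realType) (q t : nat).
Hypothesis q_gt0 : (0 < q)%N.
Local Notation tape := (t.-tuple 'I_q).

Definition mean (F : tape -> R) : R := (\sum_w F w) / #|{: tape}|%:R.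

Lemma mean_le F G : (forall w, F w <= G w) -> mean F <= mean G.
Proof. by move=> leFG; rewrite ler_wpM2r ?invr_ge0 ?ler0n // ler_sum. Qed.

Lemma mean_sum (A : finType) (F : A -> tape -> R) :
  mean (fun w => \sum_a F a w) = \sum_a mean (F a).
Proof. by rewrite /mean exchange_big mulr_suml. Qed.

Lemma meanD F G : mean (fun w => F w + G w) = mean F + mean G.
Proof. by rewrite /mean big_split mulrDl. Qed.

Lemma meanZ a F : mean (fun w => a * F w) = a * mean F.
Proof. by rewrite /mean -mulr_sumr mulrA. Qed.

Lemma sum_tuple_prod (F : 'I_t -> 'I_q -> R) :
  \sum_(w : tape) \prod_i F i (tnth w i) = \prod_i \sum_r F i r.
Proof.
rewrite bigA_distr_bigA (reindex (fun f : {ffun 'I_t -> 'I_q} => [tuple f i | i < t])) /=.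
  by apply: eq_bigr => f _; apply: eq_bigr => i _; rewrite tnth_mktuple.
exists (fun w => [ffun i => tnth w i]) => [f _ | w _].
  by apply/ffunP=> i; rewrite ffunE tnth_mktuple.
by apply: eq_from_tnth => i; rewrite tnth_mktuple ffunE.
Qed.

Lemma mean_prod (A : finType) (pos : A -> 'I_t) (f : A -> 'I_q -> R) :
  injective pos ->
  mean (fun w => \prod_a f a (tnth w (pos a))) = \prod_a ((\sum_r f a r) / q%:R).
Proof.
move=> inj_pos; have nz_q : q%:R != 0 :> R by rewrite pnatr_eq0 -lt0n.
(* Extending [f] by 1 outside the image of [pos] gives a product over all tape positions, to which
   [sum_tuple_prod] applies. *)
pose F i r := if [pick a | pos a == i] is Some a then f a r else 1.
have F_pos a r : F (pos a) r = f a r.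
  by rewrite /F; case: pickP => [b /eqP/inj_pos->|/(_ a)]; rewrite ?eqxx.
have prod_pos (G : 'I_t -> R) : (forall i, i \notin pos @: setT -> G i = 1) ->
    \prod_i G i = \prod_a G (pos a).
  move=> G1; rewrite (bigID [in pos @: setT]) /= [X in _ * X]big1 ?mulr1 //.
  rewrite big_imset /=; last by move=> a b _ _; apply: inj_pos.
  by apply: eq_bigl => a; rewrite inE.
have F_npos i r : i \notin pos @: setT -> F i r = 1.
  move=> npos; rewrite /F; case: pickP => // a /eqP pos_a.
  by case/imsetP: npos; exists a; rewrite ?inE.
transitivity (mean (fun w => \prod_i F i (tnth w i))).
  congr (_ / _); apply: eq_bigr => w _.
  rewrite prod_pos; last by move=> i /F_npos.
  by apply: eq_bigr => a _; rewrite F_pos.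
rewrite /mean sum_tuple_prod card_tuple card_ord natrX.
have -> : q%:R ^+ t = \prod_(i < t) q%:R :> R by rewrite prodr_const card_ord.
rewrite -prodf_div prod_pos.
  by apply: eq_bigr => a _; congr (_ / _); apply: eq_bigr => r _; rewrite F_pos.
move=> i npos; rewrite (eq_bigr (fun=> 1)); last by move=> r _; rewrite F_npos.
by rewrite sumr_const card_ord divff.
Qed.
End Independence.

Lemma sum_ltn q m : \sum_(r < q) (r < m) = minn m q.
Proof.
elim: q => [|q IHq]; first by rewrite big_ord0 minn0.
by rewrite big_ord_recr IHq /=; case: ltnP; lia.
Qed.

(** * Probability that a symbol is still remembered *)

Section Survival.
Local Open Scope ring_scope.
Variables (R : realType) (K q : nat).
Hypothesis q_gt0 : (0 < q)%N.

(** At distance a, at most K q / a + 1 words survive; since a <= q, the rounding turns K into K +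
    1. *)
Lemma survival_prob_le i t : (i < t)%N -> (t - i <= q)%N ->
  (\sum_(r < q) (survives K q r i t)%:R) / q%:R <= K.+1%:R / (t - i)%:R :> R.
Proof.
move=> lt_it; set a := (t - i)%N => le_aq.
have a_gt0 : (0 < a)%N by rewrite subn_gt0.
rewrite -natr_sum ler_pdivrMr ?ltr0n // mulrAC ler_pdivlMr ?ltr0n // -!natrM ler_nat.
apply: (@leq_trans (((K * q) %/ a).+1 * a)).
  rewrite leq_mul2r; apply/orP; right.
  apply: leq_trans (geq_minl _ q); rewrite -sum_ltn; apply: leq_sum => r _.
  rewrite /survives -/a; case: ltnP => // lt_r; rewrite ltnS leq_divRL //.
  by rewrite (ltnW lt_r).
by rewrite !mulSnr leq_add // leq_trunc_div.
Qed.

(** At distance a < K all words survive. Otherwise at least K q / a do, and 1 - K / a <= exp(- K /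
    a). *)
Lemma death_prob_le i t : (i < t)%N ->
  (\sum_(r < q) (~~ survives K q r i t)%:R) / q%:R <= expR (- (K%:R / (t - i)%:R)) :> R.
Proof.
move=> lt_it; set a := (t - i)%N.
have a_gt0 : (0 < a)%N by rewrite subn_gt0.
have [lt_aK | le_Ka] := ltnP a K.
  rewrite big1 ?mul0r ?expR_ge0 // => r _.
  rewrite /survives -/a (leq_ltn_trans (leq_mul (leqnn _) (ltnW lt_aK))) //.
  by rewrite mulnC ltn_pmul2l ?(leq_ltn_trans _ lt_aK).
have := expR_ge1Dx (- (K%:R / a%:R) : R); apply: le_trans.
(* The ceiling of K q / a: all words below it survive. *)
pose m := ((K * q + a.-1) %/ a)%N.
have le_m : (K * q <= minn m q * a)%N.
  have := ltn_ceil (K * q + a.-1) a_gt0; rewrite -/m minnE; nia.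
have le_surv : (\sum_(r < q) ~~ survives K q r i t <= q - minn m q)%N.
  rewrite leq_subRL ?geq_minr // -sum_ltn -big_split /=.
  rewrite -[leqRHS]card_ord -sum1_card leq_sum // => r _.
  have [lt_rm|_] := ltnP r m; last by case: survives.
  rewrite /survives -/a; have := leq_trunc_div (K * q + a.-1) a; rewrite -/m => le_ma.
  by rewrite (_ : (r * a < K * q)%N) //; nia.
rewrite ler_pdivrMr ?ltr0n // -natr_sum.
apply: le_trans (_ : (q - minn m q)%:R <= _); first by rewrite ler_nat.
rewrite natrB ?geq_minr // mulrDl mul1r lerD2l mulNr lerN2 mulrAC.
by rewrite ler_pdivrMr ?ltr0n // -!natrM ler_nat.
Qed.
End Survival.

Section Window.
Variables (n D : nat) (I : seq nat).
Hypothesis sorted_I : sorted ltn I.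

(* c is the largest number such that the last c elements of I before I_k are all
   close enough to I_k; the failure of the next one makes them dense. *)
Lemma window k : k < size I -> nth 0 I k - k < D * k -> exists c,
  [/\ 0 < c <= k,
      forall k', k - c <= k' < k ->
        D * (k - k').-1 <= nth 0 I k - nth 0 I k' - (k - k')
    & nth 0 I k - nth 0 I (k - c) <= D.+1 * c].
Proof.
move=> lt_k dense.
pose close g := D * g.-1 <= nth 0 I k - nth 0 I (k - g) - g.
pose P c := (0 < c <= k) && [forall g : 'I_k.+1, (0 < g <= c) ==> close g].
have k_gt0 : 0 < k by case: (k) dense => //; rewrite muln0.
have P1 : P 1.
  rewrite /P k_gt0; apply/forallP=> g; apply/implyP=> /andP[g_gt0 le_g1].
  by have -> : g = 1 :> nat; [lia | rewrite /close muln0].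
have P_le c : P c -> c <= k by case/andP=> /andP[].
case: (ex_maxnP (ex_intro _ 1 P1) P_le) => c /andP[/andP[c_gt0 le_ck] /forallP close_c] max_c.
exists c; split=> [|k' /andP[le_k' lt_k']|]; first by rewrite c_gt0.
  have lt_g : k - k' < k.+1 by lia.
  have := close_c (Ordinal lt_g); rewrite /close /= subKn; last exact: ltnW.
  by move/implyP; apply; lia.
have gap i j : i <= j < size I -> nth 0 I i + (j - i) <= nth 0 I j.
  exact: sorted_gap.
(* If the window contains all earlier elements, the hypothesis [dense] replaces the failure of the
   next one. *)
have [lt_ck | le_kc] := ltnP c k; last first.
  have -> : c = k by lia.
  have := sorted_ge sorted_I lt_k; rewrite mulSn; lia.
have : ~~ close c.+1.
  apply/negP=> close_c1; suff /max_c : P c.+1 by rewrite ltnn.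
  rewrite /P lt_ck /=; apply/forallP=> g; apply/implyP=> /andP[g_gt0].
  rewrite leq_eqVlt => /orP[/eqP->|lt_g] //.
  by apply: (implyP (close_c g)); rewrite g_gt0.
rewrite -ltnNge /close /= => far.
have := gap (k - c.+1) (k - c); have := gap (k - c) k; rewrite mulSn; lia.
Qed.
End Window.

(** * Harmonic sums and logarithms *)

Section Estimates.
Local Open Scope ring_scope.
Variable R : realType.

(** Induction, using ln(1 - 1 / (m + 2)) <= - 1 / (m + 2). *)
Lemma harmonic_le m : \sum_(i < m.+1) (m.+1 - i)%:R^-1 <= 1 + ln m.+1%:R :> R.
Proof.
elim: m => [|m IHm]; first by rewrite big_ord1 subn0 ln1 invr1 addr0.
rewrite big_ord_recl subn0 /=.
have -> : \sum_(i < m.+1) (m.+2 - bump 0 i)%:R^-1 = \sum_(i < m.+1) (m.+1 - i)%:R^-1 :> R.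
  by apply: eq_bigr => i _; rewrite /bump add1n subSS.
apply: (le_trans (lerD (lexx _) IHm)); rewrite addrCA lerD2l.
have pos_m k : (k.+1%:R : R) \is Num.pos by rewrite posrE ltr0n.
rewrite -lerBrDr -lerN2 opprB -ln_div //.
have -> : m.+1%:R / m.+2%:R = 1 + - m.+2%:R^-1 :> R.
  have -> : m.+1%:R = m.+2%:R - 1 :> R by rewrite -[m.+2]addn1 natrD addrK.
  by rewrite mulrBl divff ?mul1r // pnatr_eq0.
apply: le_ln1Dx; rewrite ltrN2 invf_lt1 ?ltr0n // ltr1n //.
Qed.

Lemma half_le_exp : 2^-1 <= expR (- 2^-1) :> R.
Proof. by apply: le_trans (expR_ge1Dx _); lra. Qed.

Lemma ln_ge_half n : (1 < n)%N -> 2^-1 <= ln n%:R :> R.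
Proof.
move=> n_gt1; rewrite -ler_expR lnK ?posrE ?ltr0n ?(ltnW n_gt1) //.
apply: le_trans (_ : 2 <= _); last by rewrite (ler_nat _ 2).
rewrite -[leLHS]invrK -expRN -[leRHS]invrK.
by rewrite lef_pV2 ?posrE ?expR_gt0 ?invr_gt0 // half_le_exp.
Qed.
End Estimates.

Section ErrorProbability.
Local Open Scope ring_scope.
Variables (R : realType) (n K M D : nat).
Hypothesis n_gt1 : (1 < n)%N.
Let q := (n ^ 4)%N.
Let t := (clock 1 n n 0 0 + 2)%N.
Let L : R := ln n%:R.
Local Notation tape := (t.-tuple 'I_q).
Local Notation word w := (tosses 1 n true (nth 0%N [seq val r | r <- w])).

Hypothesis K_ge : 3 * D.+1%:R * L <= K%:R.
Hypothesis M_ge : 2 * (K.+1%:R * (1 + L) + 3 * L) <= M.+1%:R.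

Lemma q_gt0 : (0 < q)%N. Proof. by rewrite expn_gt0 ltnW. Qed.

Lemma toss_lt m : (m < n)%N -> (toss_time 1 n m < t)%N.
Proof. by rewrite /toss_time /t /clock !addn0 => lt_m; nia. Qed.

Lemma toss_inj : injective (toss_time 1 n).
Proof. by move=> i j; rewrite /toss_time /clock !addn0 => -[]; nia. Qed.

Lemma word_tnth (w : tape) m (lt_m : (m < n)%N) :
  word w m = tnth w (Ordinal (toss_lt lt_m)).
Proof.
rewrite /tosses (nth_map (Ordinal q_gt0)) ?size_tuple ?toss_lt //.
by rewrite (tnth_nth (Ordinal q_gt0)).
Qed.

(** Chernoff bound with base 2: by independence the mean of 2^S is a product of factors 1 + p_i <=
    exp(p_i), and the p_i sum to at most (K + 1)(1 + ln n). *)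
Lemma overflow_prob m : (m < n)%N ->
  mean (fun w : tape => (M < count (fun i => survives K q (word w i) i m) (iota 0 m))%:R)
    <= expR (- (3 * L)).
Proof.
move=> lt_m; pose S (w : tape) := (\sum_(i < m) survives K q (word w i) i m)%N.
have lt_n (i : 'I_m) : (i < n)%N by apply: ltn_trans lt_m.
pose pos i := Ordinal (toss_lt (lt_n i)).
have inj_pos : injective pos by move=> i j /(congr1 val)/toss_inj/val_inj.
pose f (i : 'I_m) (r : 'I_q) : R := 2 ^+ survives K q r i m.
have countE (w : tape) : count (fun i => survives K q (word w i) i m) (iota 0 m) = S w.
  by rewrite -sum1_count big_mkcond /= -[m in iota _ m]subn0 -/(index_iota 0 m) big_mkord.
have overflow_le (w : tape) : (M < S w)%:R <= (2 ^+ M.+1)^-1 * \prod_i f i (tnth w (pos i)).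
  have -> : \prod_i f i (tnth w (pos i)) = 2 ^+ S w.
    by rewrite expr_sum; apply: eq_bigr => i _; rewrite /f (word_tnth w (lt_n i)).
  case: ltnP => [lt_M|_]; last by rewrite mulr_ge0 ?invr_ge0 ?exprn_ge0.
  by rewrite mulrC ler_pdivlMr ?exprn_gt0 // mul1r ler_weXn2l // ler1n.
apply: (@le_trans _ _ (mean (fun w : tape =>
          (2 ^+ M.+1)^-1 * \prod_i f i (tnth w (pos i))))).
  by apply: mean_le => w; rewrite countE overflow_le.
rewrite meanZ mean_prod ?q_gt0 //.
have prod_le : \prod_(i < m) ((\sum_r f i r) / q%:R) <= expR (K.+1%:R * (1 + L)).
  apply: (@le_trans _ _ (\prod_(i < m) expR (K.+1%:R * (m - i)%:R^-1))).
    apply: ler_prod => i _; apply/andP; split.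
      by rewrite divr_ge0 ?sumr_ge0 // => r _; rewrite exprn_ge0.
    apply: le_trans (expR_ge1Dx _).
    have -> : \sum_r f i r = q%:R + \sum_(r < q) (survives K q r i m)%:R.
      rewrite -[in q%:R](card_ord q) -sumr_const -big_split; apply: eq_bigr => r _.
      by rewrite /f; case: survives => /=; ring.
    rewrite mulrDl divff ?pnatr_eq0 -?lt0n ?q_gt0 // lerD2l.
    apply: survival_prob_le => //; rewrite ?q_gt0 //.
    apply: leq_trans (leq_subr _ _) _; apply: leq_trans (ltnW lt_m) _.
    by rewrite -[leqLHS]expn1 leq_exp2l.
  rewrite -expR_sum ler_expR -mulr_sumr ler_wpM2l //.
  case: (m) lt_m => [|m'] lt_m'.
    by rewrite big_ord0 addr_ge0 // ln_ge0 // ler1n ltnW.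
  apply: le_trans (harmonic_le _ _) _; rewrite lerD2l ler_ln ?posrE ?ltr0n ?ler_nat //.
    exact: ltnW.
  exact: ltnW.
(* The factor 2 in [M_ge] compensates for the estimate 1/2 <= exp(- 1/2). *)
have two_le : (2 ^+ M.+1)^-1 <= expR (- (K.+1%:R * (1 + L) + 3 * L)).
  apply: (@le_trans _ _ (expR (- 2^-1) ^+ M.+1)).
    by rewrite -exprVn lerXn2r ?nnegrE ?expR_ge0 ?half_le_exp // invr_ge0.
  rewrite -expRM_natl ler_expR mulrN lerN2 -ler_pdivrMr ?invr_gt0 // invrK mulrC.
  exact: M_ge.
apply: (le_trans (ler_pM _ _ two_le prod_le)).
- by rewrite invr_ge0 exprn_ge0.
- by apply: prodr_ge0 => i _; rewrite divr_ge0 ?sumr_ge0 // => r _; rewrite exprn_ge0.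
by rewrite -expRD ler_expR; lra.
Qed.

(** Each of the [c] symbols is forgotten with probability at most exp(- K / ((D + 1) c)). By
    independence all are with probability at most exp(- K / (D + 1)), and [K_ge] concludes. *)
Lemma miss_prob c (a : 'I_c -> nat) m : (0 < c)%N -> (m < n)%N -> injective a ->
  (forall j, (a j < m)%N && (m - a j <= D.+1 * c)%N) ->
  mean (fun w : tape => \prod_j (~~ survives K q (word w (a j)) (a j) m)%:R)
    <= expR (- (3 * L)).
Proof.
move=> c_gt0 lt_m inj_a near_a.
have lt_am j : (a j < m)%N by case/andP: (near_a j).
have lt_n j : (a j < n)%N := ltn_trans (lt_am j) lt_m.
pose pos j := Ordinal (toss_lt (lt_n j)).
have inj_pos : injective pos by move=> i j /(congr1 val)/toss_inj/inj_a.
pose f j (r : 'I_q) : R := (~~ survives K q r (a j) m)%:R.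
apply: (@le_trans _ _ (mean (fun w : tape => \prod_j f j (tnth w (pos j))))).
  apply: mean_le => w; rewrite le_eqVlt; apply/orP; left; apply/eqP.
  by apply: eq_bigr => j _; rewrite /f (word_tnth w (lt_n j)).
rewrite mean_prod ?q_gt0 //.
have c_neq0 : c%:R != 0 :> R by rewrite pnatr_eq0 -lt0n.
apply: (@le_trans _ _ (\prod_(j < c) expR (- (K%:R / (D.+1%:R * c%:R))))).
  apply: ler_prod => j _; apply/andP; split.
    by rewrite divr_ge0 ?sumr_ge0.
  apply: le_trans (death_prob_le _ _ q_gt0 (lt_am j)) _.
  rewrite ler_expR lerN2 ler_wpM2l // lef_pV2 ?posrE -?natrM ?ltr0n ?muln_gt0 ?c_gt0 //.
    by rewrite ler_nat; case/andP: (near_a j).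
  by rewrite subn_gt0.
rewrite prodr_const card_ord -expRM_natl ler_expR mulrN lerN2.
have -> : c%:R * (K%:R / (D.+1%:R * c%:R)) = K%:R / D.+1%:R :> R.
  by rewrite [LHS]mulrC invfM mulrA divfK.
by rewrite ler_pdivlMr ?ltr0n // mulrAC.
Qed.

Section FixedInput.
Variables (T : eqType) (x y : seq T) (I J : seq nat).
Hypotheses (sz_x : size x = n) (sz_y : size y = n).
Hypotheses (sz_I : size I = lcs x y) (sz_J : size J = lcs x y).
Hypotheses (sorted_I : sorted ltn I) (sorted_J : sorted ltn J).
Hypotheses (I_n : all (gtn n) I) (J_n : all (gtn n) J).
Hypothesis IJ_match :
  forall k, (k < lcs x y)%N -> onth x (nth 0%N I k) = onth y (nth 0%N J k).

Local Notation close k k' :=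
  (D * (k - k').-1 <= nth 0 I k - nth 0 I k' - (k - k'))%N.

(** The negation of the condition [reachable] at [k]. *)
Definition missed (w : tape) k :=
  (nth 0%N I k - k < D * k)%N && [forall k' : 'I_k,
     close k k' ==> ~~ survives K q (word w (nth 0%N I k')) (nth 0%N I k') (nth 0%N I k)].

(** The alignment depends on the input alone, so the close matches supplied by [window] are fixed
    before the tosses, and [miss_prob] applies to them. *)
Lemma missed_prob k : (k < lcs x y)%N ->
  mean (fun w : tape => (missed w k)%:R) <= expR (- (3 * L)).
Proof.
move=> lt_k; have [dense | not_dense] := boolP (nth 0 I k - k < D * k)%N; last first.
  rewrite /mean big1 ?mul0r ?expR_ge0 // => w _.
  by rewrite /missed (negPf not_dense).
have lt_kI : (k < size I)%N by rewrite sz_I.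
have [c [/andP[c_gt0 le_ck] close_c near_c]] := window sorted_I lt_kI dense.
pose a (j : 'I_c) := nth 0%N I (k - c + j).
have lt_j (j : 'I_c) : (k - c + j < k)%N by have := ltn_ord j; lia.
have lt_jI (j : 'I_c) : (k - c + j < size I)%N := ltn_trans (lt_j j) lt_kI.
have lt_kn : (nth 0%N I k < n)%N by move/all_nthP: I_n; apply.
have a_inj : injective a.
  move=> i j /eqP; rewrite nth_uniq ?lt_jI //; last exact: sorted_uniq ltn_trans ltnn _ sorted_I.
  by rewrite eqn_add2l => /eqP/val_inj.
have a_near j : (a j < nth 0%N I k)%N && (nth 0%N I k - a j <= D.+1 * c)%N.
  rewrite /a (sorted_ltn_nth ltn_trans) ?inE ?lt_jI //=.
  apply: leq_trans near_c; rewrite leq_sub2l //.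
  have := @sorted_gap I (k - c) (k - c + j) sorted_I; rewrite leq_addr lt_jI; lia.
apply: le_trans (miss_prob c_gt0 lt_kn a_inj a_near).
apply: mean_le => w; have [/andP[_ /forallP miss] | _] := boolP (missed w k); last first.
  by apply: prodr_ge0 => j _.
rewrite big1 // => j _; have /implyP -> // := miss (Ordinal (lt_j j)).
by apply: close_c; rewrite leq_addr lt_j.
Qed.

Definition good_output v := (edit_dist x y <= v)%N &&
  (D * (v - edit_dist x y) <= edit_dist x y)%N.

Lemma good_run (w : tape) :
  (forall m, (m < n)%N ->
     (count (fun i => survives K q (word w i) i m) (iota 0 m) <= M)%N) ->
  (forall k, (k < lcs x y)%N -> ~~ missed w k) ->
  oapp good_output false (tape_answer (chain_machine n K M q) x y w).
Proof.
move=> le_M hit; have sz_w : (t <= size [seq val r | r <- w])%N.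
  by rewrite size_map size_tuple.
have [|v [ans le_v ge_v]] := chain_machine_answer (D := D) (ltnW n_gt1) sz_x sz_y sz_w
    le_M sz_I sz_J sorted_I sorted_J I_n J_n IJ_match.
  move=> k lt_k; have := hit k lt_k; rewrite /missed negb_and -leqNgt.
  case/orP=> [|/forallPn[k']]; first by left.
  by rewrite negb_imply negbK => /andP[cl surv]; right; exists k'.
by rewrite /tape_answer ans /= /good_output le_v.
Qed.

(** Union bound over [n] possible overflows and at most [n] possible misses. *)
Lemma error_prob_le :
  error_prob (chain_machine n K M q) x y R q t good_output
    <= 2 * n%:R * expR (- (3 * L)).
Proof.
pose over m (w : tape) : R :=
  (M < count (fun i => survives K q (word w i) i m) (iota 0 m))%:R.
have -> : error_prob (chain_machine n K M q) x y R q t good_output =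
    mean (fun w : tape =>
      (~~ oapp good_output false (tape_answer (chain_machine n K M q) x y w))%:R).
  rewrite /error_prob /mean; congr (_ / _).
  rewrite -sum1_card natr_sum big_mkcond; apply: eq_bigr => w _.
  by rewrite inE; case: (~~ _).
apply: (@le_trans _ _ (mean (fun w : tape =>
    \sum_(m < n) over m w + \sum_(k < lcs x y) (missed w k)%:R))).
  apply: mean_le => w; rewrite -!natr_sum -natrD ler_nat.
  have [good|bad] := boolP (oapp _ _ _) => //=.
  have sum_gt0 N (P : pred 'I_N) : (exists i, P i) -> (0 < \sum_i P i)%N.
    by case=> i Pi; rewrite (bigD1 i) //= Pi.
  rewrite addn_gt0; apply/orP.
  have [/existsP/sum_gt0|/existsPn no_over] := boolP [exists m : 'I_n,
      M < count (fun i => survives K q (word w i) i m) (iota 0 m)]%N; first by left.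
  have [/existsP/sum_gt0|/existsPn no_miss] := boolP [exists k : 'I_(lcs x y),
      missed w k]; first by right.
  case/negP: bad; apply: good_run => [m lt_m | k lt_k].
    by rewrite leqNgt; apply: (no_over (Ordinal lt_m)).
  exact: (no_miss (Ordinal lt_k)).
rewrite meanD !mean_sum -mulrA mulr_natl mulr2n; apply: lerD.
  rewrite mulr_natl -[n in leRHS]card_ord -sumr_const ler_sum // => m _.
  exact: overflow_prob.
have le_l : (lcs x y <= n)%N by rewrite -sz_x lcs_sizel.
apply: (@le_trans _ _ ((lcs x y)%:R * expR (- (3 * L)))); last first.
  by rewrite ler_wpM2r ?expR_ge0 ?ler_nat.
rewrite mulr_natl -[lcs x y in leRHS]card_ord -sumr_const ler_sum // => k _.
exact: missed_prob.
Qed.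
End FixedInput.
End ErrorProbability.

(** * Choice of the constants *)

Local Open Scope ring_scope.

Section Tuning.
Variable R : realType.
Implicit Types (n : nat) (delta : R).

Definition density delta : nat := (Num.truncn delta^-1).+1.

Definition lifetime n delta : nat :=
  (Num.truncn (3 * (density delta).+1%:R * ln (n%:R : R))).+1.

Definition capacity n delta : nat :=
  Num.truncn (2 * ((lifetime n delta).+1%:R * (1 + ln (n%:R : R)) + 3 * ln (n%:R : R))).

(** For small [delta] the square root may exceed [n], whence the minimum. *)
Definition block_size n delta : nat :=
  minn n (Num.truncn (Num.sqrt (n%:R * ln (n%:R : R) / delta))).+1.

Definition resolution n delta : nat :=
  (Num.truncn (2 * (n %/ block_size n delta).+1%:R / delta)).+1.

(** Index 2 n suffices as [grid] is at least the identity. The other bound is [grid_double] with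
    exponent log n + 2, for which the power of two exceeds 2 n. *)
Definition front_count n delta : nat :=
  (minn (2 * n) (resolution n delta * (trunc_log 2 n).+3)).+1.

Variables (n : nat) (delta : R).
Hypotheses (n_gt1 : (1 < n)%N) (delta_gt0 : 0 < delta) (delta_le1 : delta <= 1).
Let L : R := ln n%:R.
Let u : R := delta^-1.

Lemma inv_delta_ge1 : 1 <= u. Proof. by rewrite invf_ge1. Qed.
Lemma ln_n_ge : 2^-1 <= L. Proof. exact: ln_ge_half. Qed.

Lemma density_le : (density delta)%:R <= 2 * u.
Proof.
have u1 := inv_delta_ge1; have le_u : (Num.truncn u)%:R <= u by rewrite truncn_le; lra.
by rewrite /density -/u -natr1; lra.
Qed.

Lemma density_ge : u <= (density delta)%:R.
Proof. exact/ltW/truncnS_gt. Qed.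

(** As 1 / delta >= 1 and ln n >= 1/2, all lower-order terms are absorbed by (ln n)^2 / delta. *)
Lemma chain_space_le k : (0 < k)%N ->
  (((capacity n delta).+1 * (k + 3) + 14)%N%:R : R) <= 432 * (k%:R * L ^+ 2 / delta).
Proof.
move=> k_gt0; have u1 := inv_delta_ge1; have L1 := ln_n_ge; rewrite -/u.
have L_le : L <= u * L by rewrite ler_peMl //; lra.
have K_le : (lifetime n delta).+1%:R <= 13 * (u * L).
  have le_K0 : (Num.truncn (3 * (density delta).+1%:R * L))%:R <=
      3 * (density delta).+1%:R * L.
    by rewrite truncn_le !mulr_ge0 //; lra.
  rewrite /lifetime -/L -addn2 natrD.
  have : 3 * (density delta).+1%:R * L <= 9 * (u * L).
    have := density_le; rewrite -[(density delta).+1%:R]natr1 => le_D.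
    have -> : 9 * (u * L) = 3 * (3 * u) * L by ring.
    by rewrite ler_wpM2r //; lra.
  lra.
have M_le : (capacity n delta)%:R <= 90 * (u * L ^+ 2).
  have KL_ge0 : 0 <= (lifetime n delta).+1%:R * (1 + L) by rewrite mulr_ge0 //; lra.
  apply: (@le_trans _ _ (2 * ((lifetime n delta).+1%:R * (1 + L) + 3 * L))).
    by rewrite truncn_le -/L; move: (_ * (1 + L)) KL_ge0 => X X_ge0; lra.
  have : (lifetime n delta).+1%:R * (1 + L) <= 13 * (u * L) * (3 * L).
    by rewrite ler_pM //; lra.
  move: (_.+1%:R * (1 + L)) KL_ge0 => X _ le_X.
  have : L <= 2 * (u * L ^+ 2).
    have : L * 1 <= (u * L) * (2 * L) by rewrite ler_pM //; lra.
    rewrite expr2; lra.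
  rewrite expr2; lra.
have one_le : 1 <= 4 * (u * L ^+ 2).
  have : 1 * 1 <= (2 * (u * L)) * (2 * L) by rewrite ler_pM //; lra.
  rewrite expr2; lra.
have k1 : 1 <= k%:R :> R by rewrite ler1n.
rewrite natrD natrM natrD -[_.+1%:R]natr1.
have : ((capacity n delta)%:R + 1) * (k%:R + 3) <= 94 * (u * L ^+ 2) * (4 * k%:R).
  by rewrite ler_pM //; [rewrite addr_ge0 | lra | lra | lra].
have : 1 * 1 <= 4 * (u * L ^+ 2) * k%:R by rewrite ler_pM.
have -> : k%:R * L ^+ 2 * u = u * L ^+ 2 * k%:R by ring.
set z := u * L ^+ 2 * k%:R.
have -> : 94 * (u * L ^+ 2) * (4 * k%:R) = 376 * z by rewrite /z; ring.
have -> : 4 * (u * L ^+ 2) * k%:R = 4 * z by rewrite /z; ring.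
lra.
Qed.

Let s : R := Num.sqrt (n%:R * L / delta).

Lemma scale_sqr : s ^+ 2 = n%:R * L / delta.
Proof.
rewrite sqr_sqrtr // divr_ge0 ?mulr_ge0 ?(ltW delta_gt0) //.
by have := ln_n_ge; lra.
Qed.

Lemma scale_ge1 : 1 <= s.
Proof.
have s_ge0 : 0 <= s by apply: sqrtr_ge0.
rewrite -(@ler_pXn2r _ 2) ?nnegrE // expr1n scale_sqr -/u.
have n2 : 2 <= n%:R :> R by rewrite (ler_nat _ 2).
have L1 := ln_n_ge; have u1 := inv_delta_ge1.
have nL2 : 2 * 2^-1 <= n%:R * L by rewrite ler_pM //; lra.
have nL1 : 1 <= n%:R * L by lra.
by rewrite -[leLHS]mulr1 ler_pM.
Qed.

Lemma block_size_bounds : (0 < block_size n delta <= n)%N.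
Proof. by rewrite leq_min geq_minl (ltnW n_gt1). Qed.

Lemma block_size_le : (block_size n delta)%:R <= 2 * s.
Proof.
apply: (@le_trans _ _ (Num.truncn s).+1%:R); first by rewrite ler_nat geq_minr.
have le_s : (Num.truncn s)%:R <= s by rewrite truncn_le sqrtr_ge0.
by rewrite -natr1; have := scale_ge1; lra.
Qed.

Lemma resolution_ge : 2 * (n %/ block_size n delta).+1%:R / delta <= (resolution n delta)%:R.
Proof. exact/ltW/truncnS_gt. Qed.

Lemma resolution_ge2 : (2 * (n %/ block_size n delta).+1 <= resolution n delta)%N.
Proof.
rewrite -(ler_nat R) natrM; apply: le_trans resolution_ge.
by rewrite -/u ler_peMr ?inv_delta_ge1 // mulr_ge0.
Qed.

Lemma front_count_grid : (2 * n <= grid (resolution n delta) (front_count n delta).-1)%N.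
Proof.
rewrite /front_count /= /minn; case: ifP => _.
  by apply: leq_grid.
apply: leq_trans (@grid_double (resolution n delta) isT _).
by rewrite expnS leq_mul2l /= ltnW // trunc_log_ltn.
Qed.

Lemma trunc_log_le : (trunc_log 2 n)%:R <= 2 * L.
Proof.
have := trunc_logP (isT : (1 < 2)%N) (ltnW n_gt1).
rewrite -(ler_nat R) natrX -ler_ln ?posrE ?exprn_gt0 ?ltr0n ?(ltnW n_gt1) //.
rewrite lnXn // -/L -[ln _ *+ _]mulr_natl => le_L.
have le2 : 2^-1 <= ln 2%:R :> R by apply: ln_ge_half.
have : (trunc_log 2 n)%:R * 2^-1 <= (trunc_log 2 n)%:R * ln 2%:R :> R.
  by rewrite ler_wpM2l.
lra.
Qed.

Lemma front_count_le : (front_count n delta)%:R <= 41 * s.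
Proof.
have s1 := scale_ge1; have u1 := inv_delta_ge1; have L1 := ln_n_ge; rewrite /front_count -natr1.
have [le_ns | lt_sn] := lerP n%:R s.
  apply: (@le_trans _ _ ((2 * n)%:R + 1)); first by rewrite lerD2r ler_nat geq_minl.
  by rewrite natrM; lra.
apply: (@le_trans _ _ ((resolution n delta * (trunc_log 2 n).+3)%:R + 1)).
  by rewrite lerD2r ler_nat geq_minr.
set b := block_size n delta.
have s_gt0 : 0 < s by lra.
have s_le : s <= b%:R.
  rewrite /b /block_size -/L -/s (minn_idPr _); first exact/ltW/truncnS_gt.
  by rewrite truncn_lt_nat // ltW.
have nb_le : (n %/ b).+1%:R <= 2 * (n%:R / s).
  have : (n %/ b)%:R <= n%:R / s :> R.
    rewrite ler_pdivlMr //; apply: (@le_trans _ _ ((n %/ b)%:R * b%:R)).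
      by rewrite ler_wpM2l.
    by rewrite -natrM ler_nat leq_trunc_div.
  have : 1 <= n%:R / s by rewrite ler_pdivlMr // mul1r ltW.
  by rewrite -natr1; lra.
have ns_ge1 : 1 <= n%:R / s by rewrite ler_pdivlMr // mul1r ltW.
have N_le : (resolution n delta)%:R <= 5 * (n%:R / s * u).
  have le_N : (Num.truncn (2 * (n %/ b).+1%:R / delta))%:R <= 2 * (n %/ b).+1%:R / delta.
    by rewrite truncn_le divr_ge0 ?mulr_ge0 ?(ltW delta_gt0).
  have : 2 * (n %/ b).+1%:R / delta <= 4 * (n%:R / s * u).
    have -> : 4 * (n%:R / s * u) = 2 * (2 * (n%:R / s)) * u by ring.
    by rewrite -/u ler_wpM2r ?ler_wpM2l //; lra.
  have : 1 * 1 <= n%:R / s * u by rewrite ler_pM.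
  rewrite /resolution -natr1; lra.
have log_le : (trunc_log 2 n).+3%:R <= 8 * L.
  by have := trunc_log_le; rewrite -!natr1; lra.
have : (resolution n delta)%:R * (trunc_log 2 n).+3%:R <= 5 * (n%:R / s * u) * (8 * L).
  by rewrite ler_pM.
(* The product is 40 (n ln n / delta) / s, and the numerator is s^2: this is the balance behind the
   block size. *)
have -> : 5 * (n%:R / s * u) * (8 * L) = 40 * s.
  have -> : 5 * (n%:R / s * u) * (8 * L) = 40 * ((n%:R * L / delta) / s).
    by rewrite /u; ring.
  by rewrite -scale_sqr expr2 mulfK // gt_eqF.
by rewrite natrM; lra.
Qed.

Lemma front_space_le :
  ((3 * block_size n delta + 2 * front_count n delta + 14)%N%:R : R) <= 114 * s.
Proof.
rewrite !natrD !natrM; have := block_size_le; have := front_count_le.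
by have := scale_ge1; lra.
Qed.

(** The factor N / (N - nb) is at most 1 + delta because delta N >= 2 nb >= (1 + delta) nb. *)
Lemma resolution_approx (E v : nat) (N := resolution n delta)
    (nb := (n %/ block_size n delta).+1) :
  ((N - nb) * v <= N * E)%N -> v%:R <= (1 + delta) * E%:R.
Proof.
move=> le_v; have le_N := resolution_ge2; rewrite -/N -/nb in le_N.
have lt_nb : (nb < N)%N by rewrite (leq_trans _ le_N) // ltn_Pmull.
have d_gt0 : 0 < N%:R - nb%:R :> R by rewrite subr_gt0 ltr_nat.
rewrite -(ler_pM2l d_gt0); apply: (@le_trans _ _ (N%:R * E%:R)).
  by rewrite -natrB ?(ltnW lt_nb) // -!natrM ler_nat.
rewrite mulrA ler_wpM2r //.
have := resolution_ge; rewrite -/N -/nb ler_pdivrMr // => le_N'.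
have : delta * nb%:R <= nb%:R by rewrite ler_piMl.
lra.
Qed.
End Tuning.

(** * Proof of the two claims *)

Lemma max_occ_gt0 (T : eqType) (y : seq T) : (0 < size y)%N -> (0 < max_occ y)%N.
Proof.
case: y => // a y _.
apply: leq_trans (@leq_bigmax_seq _ _ xpredT (fun c => count_mem c (a :: y)) a _ isT).
  by rewrite /= eqxx.
by rewrite mem_head.
Qed.

Theorem theorem2 (R : realType) :
  (exists (b : nat) (C c : R) (A : nat -> R -> algorithm),
     0 < c /\
     forall (n : nat) (delta : R) (T : eqType) (x y : n.-tuple T),
       (2 <= n)%N -> 0 < delta <= 1 ->
       let q := (n ^ b)%N in
       runs_in_space (A n delta) x y q
         (C * ((max_occ y)%:R * ln (n%:R : R) ^+ 2 / delta)) /\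
       exists t : nat,
         halts_within (A n delta) x y q t /\
         error_prob (A n delta) x y R q t
           (additive_approx n delta (edit_dist x y)) <= n%:R `^ (- c))
  /\
  (exists (b : nat) (C : R) (A : nat -> R -> algorithm),
     forall (n : nat) (delta : R),
       (2 <= n)%N -> 0 < delta <= 1 ->
       deterministic (A n delta) /\
       forall (T : eqType) (x y : n.-tuple T),
         runs_in_space (A n delta) x y (n ^ b)%N
           (C * Num.sqrt (n%:R * ln (n%:R : R) / delta)) /\
         exists2 v : nat, computes (A n delta) x y v &
           mult_approx delta (edit_dist x y) v).
Proof.
split.
  exists 4, 432, 1, (fun n delta =>
    chain_machine n (lifetime n delta) (capacity n delta) (n ^ 4)).
  split=> // n delta T x y n_gt1 /andP[d_gt0 d_le1] q.
  have n_gt0 := ltnW n_gt1.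
  have [sz_x sz_y] : size x = n /\ size y = n by rewrite !size_tuple.
  split.
    apply: chain_machine_space => //.
    by apply: chain_space_le => //; apply: max_occ_gt0; rewrite sz_y.
  exists (clock 1 n n 0 0 + 2)%N; split=> [w|].
    rewrite /tape_answer /chain_machine (@block_machine_answer _ _ _ _ _ _ _ _ _ _ _ _ _
      sz_x sz_y n_gt0) // size_map size_tuple //.
  have [I [J [sz_I sz_J /andP[ss_I ss_J] /andP[I_n J_n] IJ]]] := lcs_positions x y.
  rewrite sz_x in I_n; rewrite sz_y in J_n.
  have := @error_prob_le R n (lifetime n delta) (capacity n delta) (density delta) n_gt1
    _ _ _ x y I J sz_x sz_y sz_I sz_J ss_I ss_J I_n J_n IJ.
  move=> /(_ (ltW (truncnS_gt _)) (ltW (truncnS_gt _))) err_le.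
  (* The bound is 2 n exp(- 3 ln n) = 2 / n^2 <= 1 / n, so the exponent [c] is 1. *)
  apply: le_trans (le_trans err_le _); last first.
    rewrite powR_inv1 // expRN expRM_natl lnK ?posrE ?ltr0n //.
    have n2 : 2 <= n%:R :> R by rewrite (ler_nat _ 2).
    have n_neq0 : n%:R != 0 :> R by rewrite pnatr_eq0 -lt0n.
    have -> : 2 * n%:R * (n%:R ^+ 3)^-1 = 2 / n%:R * n%:R^-1 :> R by field.
    by rewrite ler_piMl ?invr_ge0 // ler_pdivrMr ?ltr0n // mul1r.
  rewrite ler_wpM2r ?invr_ge0 // ler_nat subset_leq_card //.
  apply/fintype.subsetP => w; rewrite !inE; apply: contra.
  case: (tape_answer _ _ _ _) => //= v /andP[le_v ge_v].
  rewrite /additive_approx ler_nat le_v /=.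
  set E := edit_dist x y in le_v ge_v *.
  have E_n : E%:R <= n%:R :> R by rewrite ler_nat -sz_x leq_subr.
  (* As D is at least 1 / delta, an excess of at most E / D is at most delta E, hence at most delta
     n. *)
  have := density_ge delta; rewrite -(ler_pM2l d_gt0) divff ?gt_eqF // => D_ge.
  rewrite -lerBlDl -natrB //; apply: le_trans (_ : delta * E%:R <= _); last first.
    by rewrite ler_wpM2l // ltW.
  apply: le_trans (_ : delta * (density delta)%:R * (v - E)%:R <= _).
    by rewrite ler_peMl.
  by rewrite -mulrA ler_wpM2l ?(ltW d_gt0) // -natrM ler_nat.
exists 4, 114, (fun n delta => front_machine n (block_size n delta)
  (resolution n delta) (front_count n delta)).
move=> n delta n_gt1 /andP[d_gt0 d_le1]; split.
  exact: block_machine_deterministic.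
move=> T x y; have [sz_x sz_y] : size x = n /\ size y = n by rewrite !size_tuple.
have [|||||||space_ok [v comp_v [le_v ge_v]]] := @front_machine_correct R n
  (block_size n delta) (resolution n delta) (front_count n delta) T x y
  (114 * Num.sqrt (n%:R * ln n%:R / delta)) n_gt1.
- exact: block_size_bounds.
- exact: resolution_ge2.
- exact: front_count_grid.
- by rewrite /front_count !ltnS geq_minl.
- exact: sz_x.
- exact: sz_y.
- exact: front_space_le.
split=> //; exists v => //; rewrite /mult_approx ler_nat le_v.
exact: resolution_approx ge_v.
Qed.
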